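(* For every $n$, the maximum, over all $n \times n$ arrays $A$, of the number of distinct tandems occurring in $A$ is $\Theta(n^3)$. Moreover, all distinct tandems occurring in an $n \times n$ array can be reported in the optimal $\Theta(n^3)$ time.
   Context: A 2D-string (array) $A$ of size $m\times n$ has cells $A[i,j]$; $A[i_1 \,..\, i_2, j_1 \,..\, j_2]$ denotes the subarray formed by rows $i_1,\dots,i_2$ and columns $j_1,\dots,j_2$. For an array $W$ and positive integers $\alpha,\beta$, $W^{\alpha,\beta}$ denotes the array composed of $\alpha \times \beta$ copies of $W$ ($\alpha$ copies stacked vertically, $\beta$ copies placed horizontally). A tandem is an array of the form $W^{1,2}$ for some array $W$ (two copies of $W$ side by side). Tandems are counted as distinct by content (two occurrences with equal content at different positions count once). *)

(* Defs.v *)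
From HB Require Import structures.
From mathcomp Require Import all_boot all_order all_algebra.
From mathcomp Require Import boolp classical_sets topology normedtype landau.
Import numFieldNormedType.Exports.

Set Implicit Arguments.
Unset Strict Implicit.
Unset Printing Implicit Defensive.

(* Arrays of all sizes in one type, so that arrays of different sizes are
   different contents. *)
Definition array (T : eqType) : eqType := {d : nat * nat & 'M[T]_(d.1, d.2)}.

Definition Array (T : eqType) m n (A : 'M[T]_(m, n)) : array T :=
  existT (fun d : nat * nat => 'M[T]_(d.1, d.2)) (m, n) A.

(* Rows and columns are numbered from 0. *)
Record occurrence (m n : nat) := Occurrence {
  occ_top : nat; occ_left : nat; occ_height : nat; occ_width : nat;
  occ_rows : occ_top + occ_height <= m;
  occ_cols : occ_left + occ_width <= n }.

Definition subarray (T : eqType) m n (A : 'M[T]_(m, n)) (o : occurrence m n) :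
    array T :=
  Array
    (mxsub (fun r : 'I_(occ_height o) => widen_ord (occ_rows o) (rshift _ r))
           (fun s : 'I_(occ_width o) => widen_ord (occ_cols o) (rshift _ s)) A).

(* [row_mx W W] is W^{1,2}; W ranges over nonempty arrays. *)
Definition is_tandem (T : eqType) (B : array T) : Prop :=
  exists h w (W : 'M[T]_(h, w)),
    [/\ 0 < h, 0 < w & B = Array (row_mx W W)].

Definition tandem_of (T : eqType) m n (A : 'M[T]_(m, n)) (B : array T) : Prop :=
  is_tandem B /\ exists o : occurrence m n, B = subarray A o.

Definition lists_distinct_tandems (T : eqType) m n (A : 'M[T]_(m, n))
    (s : seq (array T)) : Prop :=
  uniq s /\ forall B, B \in s <-> tandem_of A B.

(* The alphabet is arbitrary, so the maximum is also over all alphabets. *)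
Definition is_max_distinct_tandems (n M : nat) : Prop :=
  (exists (T : eqType) (A : 'M[T]_n) s,
     lists_distinct_tandems A s /\ size s = M) /\
  (forall (T : eqType) (A : 'M[T]_n) s,
     lists_distinct_tandems A s -> size s <= M).

Definition is_Theta (f g : nat -> nat) : Prop :=
  (fun n => (f n)%:R%R : (rat^o)%type)
    \is 'Theta_(\oo%classic) (fun n => (g n)%:R%R : (rat^o)%type).

Definition is_Omega (f g : nat -> nat) : Prop :=
  (fun n => (f n)%:R%R : (rat^o)%type)
    \is 'Omega_(\oo%classic) (fun n => (g n)%:R%R : (rat^o)%type).

(* Structured word-RAM programs over [b]-bit words, i.e. naturals below [2 ^ b].
   A state has registers (named in the program), a memory with computed word
   addresses, and an output stream.  Every operation, memory access, literal, register access, control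
   test and emitted word has unit cost. *)
Inductive binop :=
  | OpAdd | OpSub | OpMul | OpDiv | OpMod
  | OpAnd | OpOr | OpXor | OpShl | OpShr | OpLt | OpEq.

Inductive expr :=
  | Lit of nat
  | Reg of nat
  | Fetch of expr
  | Bin of binop & expr & expr.

Inductive prog :=
  | Skip
  | Assign of nat & expr
  | Store of expr & expr   (* address, value *)
  | Output of expr
  | Seq of prog & prog
  | If of expr & prog & prog
  | While of expr & prog.

Record state := State {
  st_reg : nat -> nat;
  st_mem : nat -> nat;
  st_out : seq nat }.

Definition binop_eval (b : nat) (op : binop) (x y : nat) : nat :=
  match op with
  | OpAdd => x + y
  | OpSub => x + 2 ^ b - y
  | OpMul => x * y
  | OpDiv => x %/ y
  | OpMod => x %% y
  | OpAnd => Nat.land x y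
  | OpOr => Nat.lor x y
  | OpXor => Nat.lxor x y
  | OpShl => x * 2 ^ y
  | OpShr => x %/ 2 ^ y
  | OpLt => x < y
  | OpEq => x == y
  end %% 2 ^ b.

Fixpoint eval (b : nat) (s : state) (e : expr) : nat :=
  match e with
  | Lit v => v %% 2 ^ b
  | Reg x => st_reg s x
  | Fetch a => st_mem s (eval b s a)
  | Bin op e1 e2 => binop_eval b op (eval b s e1) (eval b s e2)
  end.

Fixpoint cost (e : expr) : nat :=
  match e with
  | Lit _ | Reg _ => 1
  | Fetch a => (cost a).+1
  | Bin _ e1 e2 => (cost e1 + cost e2).+1
  end.

(* [exec b p s s' k]: on [b]-bit words, [p] started in [s] halts in [s'] after
   exactly [k] time units. *)
Inductive exec (b : nat) : prog -> state -> state -> nat -> Prop :=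
  | ExecSkip s : exec b Skip s s 1
  | ExecAssign s x e :
      exec b (Assign x e) s
        (State [eta st_reg s with x |-> eval b s e] (st_mem s) (st_out s)) (cost e).+1
  | ExecStore s a e :
      exec b (Store a e) s
        (State (st_reg s) [eta st_mem s with eval b s a |-> eval b s e] (st_out s))
        (cost a + cost e).+1
  | ExecOutput s e :
      exec b (Output e) s
        (State (st_reg s) (st_mem s) (rcons (st_out s) (eval b s e))) (cost e).+1
  | ExecSeq p q s s1 s2 k1 k2 :
      exec b p s s1 k1 -> exec b q s1 s2 k2 ->
      exec b (Seq p q) s s2 (k1 + k2)
  | ExecIf e p q s s' k :
      exec b (if eval b s e != 0 then p else q) s s' k ->
      exec b (If e p q) s s' (cost e + k).+1
  | ExecWhileDone e p s :
      eval b s e = 0 -> exec b (While e p) s s (cost e).+1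
  | ExecWhileStep e p s s1 s2 k1 k2 :
      eval b s e != 0 -> exec b p s s1 k1 -> exec b (While e p) s1 s2 k2 ->
      exec b (While e p) s s2 (cost e + k1 + k2).+1.

(* Input convention: register 0 holds [n], the memory holds the letters in
   row-major order from address 0; everything else is 0. *)
Definition init n (A : 'M[nat]_n) : state :=
  State [eta (fun=> 0) with 0 |-> n]
        (nth 0 [seq A i j | i <- enum 'I_n, j <- enum 'I_n])
        [::].

(* An array is reported through one of its occurrences, as four words. *)
Definition occ_code m n (o : occurrence m n) : seq nat :=
  [:: occ_top o; occ_left o; occ_height o; occ_width o].

Definition reports_distinct_tandems (T : eqType) m n (A : 'M[T]_(m, n))
    (ws : seq nat) : Prop :=
  exists os : seq (occurrence m n),
    ws = flatten [seq occ_code o | o <- os] /\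
    lists_distinct_tandems A [seq subarray A o | o <- os].

(* [t n] bounds the worst-case time of [p] over all n x n arrays whose letters
   are machine words, for every word length of at least (c + 2) log2 (n + 2)
   bits; the summand 2 makes [n] and the addresses of the input words. *)
Definition reports_in_time (p : prog) (c : nat) (t : nat -> nat) : Prop :=
  forall n b (A : 'M[nat]_n),
    n.+2 ^ c.+2 <= 2 ^ b -> (forall i j, A i j < 2 ^ b) ->
    exists s k,
      [/\ exec b p (init A) s k, k <= t n & reports_distinct_tandems A (st_out s)].

(* Main.v *)
From mathcomp Require Import all_boot all_order all_algebra.
From mathcomp Require Import zify.
From mathcomp Require Import boolp classical_sets topology normedtype landau.
Require Import Defs.
Import Order.TTheory GRing.Theory Num.Theory.

Set Implicit Arguments.
Unset Strict Implicit.
Unset Printing Implicit Defensive.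

(* Counting.  Give each distinct tandem its rightmost occurrence.  For fixed top
   row, left column and height the strip of rows is a string of columns, and three
   squares starting at one position force the smallest one to occur again further
   right (Fraenkel-Simpson), so at most two tandems share a position: at most 2 n^3
   in total.  The array whose row i is constantly i has at least (n/2)^3 tandems.

   Reporting.  Fix the width p of the repeated half and name the row segments of
   width p, equal names for equal segments; segments of width p + 1 are named by
   the pair of their two overlapping subsegments of width p.  Every column j then
   holds vertical runs of rows i whose segments at j and j + p have equal names,
   and the tandems of width 2p are the factors of the words of names spelled by
   these runs.  An on-line suffix trie of all runs has one node per distinct
   factor and is built in time linear in its number of nodes plus the number of
   cells.  Zero-initialised memory of polynomial size serves as the dictionaries.
   Over all p this is O(n^3) plus the number of distinct tandems. *)

(** * Squares in strips of rows *)

Definition has_period (S : Type) (s : nat -> S) p l :=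
  forall x, x + p < l -> s x = s (x + p).

Lemma has_period_mod (S : Type) (s : nat -> S) p l x :
  has_period s p l -> x < l -> s x = s (x %% p).
Proof.
move=> Hp; case: (posnP p) => [->|p0]; first by rewrite modn0.
elim/ltn_ind: x => x IH xl; case: (ltnP x p) => [xp|px]; first by rewrite modn_small.
have -> : x %% p = (x - p) %% p by rewrite -{1}(subnK px) modnDr.
rewrite -IH; [|lia|lia].
by rewrite [RHS]Hp subnK.
Qed.

Lemma mod_has_period (S : Type) (s : nat -> S) p l :
  (forall x, x < l -> s x = s (x %% p)) -> has_period s p l.
Proof. by move=> H x xl; rewrite (H x) ?(H (x + p)) ?modnDr //; lia. Qed.

(** Subtractive Euclid: for [d <= e] also [e - d] is a period, by a step back by [d] and a step
    forward by [e], taken in the other order when [x < d]; [d + e <= l] keeps both steps inside. *)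
Lemma fine_wilf (S : Type) (s : nat -> S) d e l : d + e <= l ->
  has_period s d l -> has_period s e l -> has_period s (gcdn d e) l.
Proof.
elim/ltn_ind: {d e}(d + e) {1 3 4 5}d {1 3 4 5}e (erefl (d + e)) => m IH d e Em.
wlog le_de : d e Em / d <= e.
  move=> W; case: (leqP d e) => [|/ltnW] de; first exact: W.
  by rewrite gcdnC => ml Hd He; apply: W => //; rewrite addnC.
move=> ml Hd He; case: (posnP d) => [->|d0]; first by rewrite gcd0n.
have -> : gcdn d e = gcdn d (e - d) by rewrite -{1}(subnK le_de) gcdnDr.
apply: (IH (d + (e - d))) => //; [lia|lia|].
move=> x xl; case: (leqP d x) => dx.
- have -> : s x = s (x - d) by rewrite (Hd (x - d)) subnK //; lia.
  by rewrite He; [congr s; lia|lia].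
- rewrite He; [|lia].
  by rewrite (Hd (x + (e - d))); [congr s; lia|lia].
Qed.

(* Squares of roots u, v, w at one position with |u| < |v| < |w| < 2|u|: the
   overlaps make |v| - |u| and |w| - |v| periods of u, and their gcd together
   with |u| forces vv to be a power of a word of length at most |v| - |u|. *)
Lemma three_squares (S : Type) (s : nat -> S) p q r : 0 < p -> p < q -> q < r ->
  has_period s p p.*2 -> has_period s q q.*2 -> has_period s r r.*2 ->
  exists2 g, 0 < g <= (r - p).*2 & forall x, x < p.*2 -> s x = s (x + g).
Proof.
move=> p0 pq qr Hp Hq Hr; case: (leqP p.*2 r) => [pr|rp].
  by exists r => [|x xp]; [lia|apply: Hr; lia].
have overlap a b : a < b -> b < a.*2 -> has_period s a a.*2 ->
    has_period s b b.*2 -> has_period s (b - a) a.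
  move=> ab ba Ha Hb x xl; rewrite Hb; last lia.
  by rewrite (Ha (x + (b - a))); [congr s; lia|lia].
have Hd := overlap _ _ pq (ltn_trans qr rp) Hp Hq.
have He : has_period s (r - q) q by apply: overlap => //; lia.
have Hg : has_period s (gcdn (q - p) (r - q)) p.
  by apply: fine_wilf => //; [lia|move=> x xl; apply: He; lia].
set g := gcdn _ _ in Hg.
have g_d : g %| q - p by apply: dvdn_gcdl.
have g_e : g %| r - q by apply: dvdn_gcdr.
have g_le : g <= q - p by apply: dvdn_leq => //; lia.
(* The first [q] letters repeat their first [r - q <= p] letters; there [g] is a period, and it
   divides [r - q]. *)
have Hg' : has_period s g q.
  apply: mod_has_period => x xq.
  rewrite (has_period_mod He xq) (has_period_mod Hg) ?modn_dvdm //.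
  by apply: leq_trans (ltn_pmod _ _) _; lia.
have Hk : has_period s (gcdn p g) q.
  by apply: fine_wilf => //; [lia|move=> x xl; apply: Hp; lia].
set k := gcdn p g in Hk.
have k0 : 0 < k by rewrite gcdn_gt0 p0.
have k_q : k %| q.
  by rewrite -(subnKC (ltnW pq)) dvdn_add ?dvdn_gcdl // (dvdn_trans (dvdn_gcdr _ _)).
have k_le : k <= q - p by apply: leq_trans (dvdn_leq _ (dvdn_gcdr _ _)) _ => //; lia.
exists k => [|x xp]; first lia.
(* Since [k] divides the period [q], its validity on the first [q] letters extends to all [q.*2]. *)
apply: (@mod_has_period _ _ _ q.*2); last lia.
move=> y yq; rewrite (has_period_mod Hq yq) (has_period_mod Hk) ?modn_dvdm //.
by apply: ltn_pmod; lia.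
Qed.

(** * Positions and contents of tandems *)

Definition entry (T : Type) m n (A : 'M[T]_(m, n)) (i j : nat) : option T :=
  if insub i is Some i' then if insub j is Some j' then Some (A i' j') else None
  else None.

Lemma entry_ord (T : Type) m n (A : 'M[T]_(m, n)) (i : 'I_m) (j : 'I_n) :
  entry A i j = Some (A i j).
Proof. by rewrite /entry !valK. Qed.

(** The last component is the width of the repeated half; the tandem is twice as wide. *)
Definition quad := (nat * nat * nat * nat)%type.
Notation top q := (q.1.1.1) (only parsing).
Notation left q := (q.1.1.2) (only parsing).
Notation height q := (q.1.2) (only parsing).
Notation period q := (q.2) (only parsing).

(** Plain data in place of a dependent matrix, so that contents of different sizes compare without
    casts. *)
Definition content (T : Type) m n (A : 'M[T]_(m, n)) (q : quad) :=
  (height q, (period q).*2,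
   mkseq (fun r => mkseq (fun c => entry A (top q + r) (left q + c)) (period q).*2)
     (height q)).

Definition tandem_at (T : eqType) m n (A : 'M[T]_(m, n)) (q : quad) :=
  [&& 0 < height q, 0 < period q, top q + height q <= m, left q + (period q).*2 <= n &
   all (fun r => all (fun c => entry A (top q + r) (left q + c)
                     == entry A (top q + r) (left q + c + period q))
          (iota 0 (period q))) (iota 0 (height q))].

Lemma eq_mkseqP (S : eqType) (f g : nat -> S) k :
  mkseq f k = mkseq g k <-> forall r, r < k -> f r = g r.
Proof.
split=> [E r rk|E]; first by rewrite -(nth_mkseq (f 0) f rk) E nth_mkseq.
by apply/eq_in_map => r; rewrite mem_iota => /andP[_]; apply: E.
Qed.

Lemma contentP (T : eqType) m n (A : 'M[T]_(m, n)) (q q' : quad) :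
  content A q = content A q' <->
  [/\ height q = height q', period q = period q' &
    forall r c, r < height q -> c < (period q).*2 ->
    entry A (top q + r) (left q + c) = entry A (top q' + r) (left q' + c)].
Proof.
rewrite /content; split.
  case=> Eh /double_inj Ew; rewrite -Eh -Ew => /eq_mkseqP E.
  by split=> // r c rh cw; have /eq_mkseqP := E r rh; apply.
case=> Eh Ew E; rewrite -Eh -Ew; congr (_, _, _); apply/eq_mkseqP => r rh.
by apply/eq_mkseqP => c cw; apply: E.
Qed.

Lemma tandem_atP (T : eqType) m n (A : 'M[T]_(m, n)) (q : quad) :
  reflect [/\ 0 < height q, 0 < period q, top q + height q <= m,
              left q + (period q).*2 <= n &
    forall r c, r < height q -> c < period q ->
    entry A (top q + r) (left q + c) = entry A (top q + r) (left q + c + period q)]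
    (tandem_at A q).
Proof.
apply: (iffP and5P) => [] [-> -> -> -> H]; split=> //.
  move=> r c rh cw; move/allP: H => /(_ r); rewrite mem_iota => /(_ rh)/allP/(_ c).
  by rewrite mem_iota => /(_ cw)/eqP.
apply/allP => r; rewrite mem_iota => /andP[_ rh]; apply/allP => c.
by rewrite mem_iota => /andP[_ cw]; apply/eqP/H.
Qed.

Lemma quad_eta (q : quad) : q = (top q, left q, height q, period q).
Proof. by case: q => [[[]]]. Qed.

Definition strip (T : Type) m n (A : 'M[T]_(m, n)) i h j : seq (option T) :=
  mkseq (fun r => entry A (i + r) j) h.

Lemma tandem_at_period (T : eqType) m n (A : 'M[T]_(m, n)) (q : quad) :
  tandem_at A q ->
  has_period (fun x => strip A (top q) (height q) (left q + x)) (period q) (period q).*2.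
Proof.
case/tandem_atP=> _ _ _ _ H x xl; apply/eq_mkseqP => r rh.
by rewrite H // ?addnA //; lia.
Qed.

(* The right end of the largest square bounds the shift, so the shifted square
   stays inside the array. *)
Lemma three_tandems (T : eqType) m n (A : 'M[T]_(m, n)) (q q1 q2 : quad) :
  tandem_at A q -> tandem_at A q1 -> tandem_at A q2 ->
  top q1 = top q -> top q2 = top q -> left q1 = left q -> left q2 = left q ->
  height q1 = height q -> height q2 = height q ->
  period q < period q1 -> period q1 < period q2 ->
  exists q', [/\ tandem_at A q', content A q' = content A q & left q < left q'].
Proof.
move=> Hq H1 H2 t1 t2 l1 l2 h1 h2 p1 p2.
have := tandem_at_period H1; have := tandem_at_period H2.
rewrite t1 t2 l1 l2 h1 h2 => P2 P1.
have q0 : 0 < period q by case/and5P: Hq.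
have [g /andP[g0 gl] E] := three_squares q0 p1 p2 (tandem_at_period Hq) P1 P2.
have {}E r c : r < height q -> c < (period q).*2 ->
    entry A (top q + r) (left q + g + c) = entry A (top q + r) (left q + c).
  move=> rh /E/eq_mkseqP/(_ r rh) ->; by rewrite -addnA [g + c]addnC.
exists (top q, left q + g, height q, period q); split=> /=; last lia.
  case/tandem_atP: Hq => hq wq tq lq Hq; apply/tandem_atP; split=> //=.
    by case/tandem_atP: H2; lia.
  move=> r c rh cw; rewrite -[in RHS]addnA !E ?addnA ?Hq //; lia.
by apply/contentP; split=> //= r c rh cw; rewrite E.
Qed.

Lemma uniq_map_transfer (X Y Z : eqType) (f : X -> Y) (g : X -> Z) (s : seq X) :
  uniq (map f s) -> {in s &, forall x y, g x = g y -> f x = f y} ->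
  uniq (map g s).
Proof.
elim: s => //= x s IH /andP[xs us] E; apply/andP; split; last first.
  by apply: IH => // y z ys zs; apply: E; rewrite inE ?ys ?zs orbT.
apply: contra xs => /mapP[y ys gxy]; apply/mapP; exists y => //.
by apply: E; rewrite ?inE ?eqxx ?ys ?orbT.
Qed.

Lemma rightmost_tandem (T : eqType) m n (A : 'M[T]_(m, n)) (q : quad) :
  tandem_at A q -> exists q', [/\ tandem_at A q', content A q' = content A q &
    forall q'', tandem_at A q'' -> content A q'' = content A q ->
    left q'' <= left q'].
Proof.
move=> Hq.
pose P l := `[< exists q', [/\ tandem_at A q', content A q' = content A q &
                            left q' = l] >].
have exP : exists l, P l by exists (left q); apply/asboolP; exists q.
have bP l : P l -> l <= n.
  by move/asboolP=> [q' [/tandem_atP[_ _ _ H _] _ <-]]; lia.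
case: (ex_maxnP exP bP) => l /asboolP[q' [H1 H2 H3]] mx.
exists q'; split=> // q'' H1'' H2''; rewrite H3; apply: mx.
by apply/asboolP; exists q''.
Qed.

(** The position of the rightmost occurrence together with one bit identifies a tandem of the list;
    there are [2 * n ^ 3] such keys. *)
Lemma distinct_tandems_bound (T : eqType) n (A : 'M[T]_n) (qs : seq quad) :
  all (tandem_at A) qs -> uniq (map (content A) qs) -> size qs <= 2 * n ^ 3.
Proof.
move=> /allP tqs uqs.
have [q|rm rmP] := @choice _ _ (fun q q' : quad => tandem_at A q ->
    [/\ tandem_at A q', content A q' = content A q & forall q'', tandem_at A q'' ->
        content A q'' = content A q -> left q'' <= left q']).
  case: (boolP (tandem_at A q)) => [/rightmost_tandem[q' H]|_]; last by exists q.
  by exists q'.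
case: n => [|n] in A tqs uqs rm rmP *.
  by case: qs tqs {uqs} => // q qs /(_ q (mem_head _ _))/tandem_atP[]; lia.
pose pos q := (top (rm q), left (rm q), height (rm q)).
(* The bit separates the two tandems that may share a position: is there a narrower one in the
   list? *)
pose smaller q := has (fun q' => (pos q' == pos q) && (period q' < period q)) qs.
pose key q : 'I_n.+1 * 'I_n.+1 * 'I_n.+1 * bool :=
  (inord (top (rm q)), inord (left (rm q)), inord (height (rm q)).-1, smaller q).
have half_rm q : q \in qs -> period (rm q) = period q.
  by move=> /tqs/rmP[_ /contentP[_ -> _] _].
have ukey : uniq (map key qs).
  apply: uniq_map_transfer uqs _ => q q' qqs q'qs [] Et El Eh Es.
  have [[H C M] [H' C' M']] := (rmP _ (tqs _ qqs), rmP _ (tqs _ q'qs)).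
  have {Et El Eh} Epos : pos q = pos q'.
    case/tandem_atP: (H) => h0 w0 t0 l0 _; case/tandem_atP: (H') => h0' w0' t0' l0' _.
    have := congr1 val Et; have := congr1 val El; have := congr1 val Eh.
    rewrite /= !inordK /pos; [|lia..] => E1 E2 E3; congr (_, _, _) => //; lia.
  wlog le_qq : q q' qqs q'qs Es H C M H' C' M' Epos / period q <= period q'.
    by move=> W; case: (leqP (period q) (period q')) => [|/ltnW] ?; [|symmetry];
      apply: W.
  case: (ltngtP (period q) (period q')) le_qq => // [lt_qq|eq_qq] _; last first.
    rewrite -C -C' [rm q]quad_eta [rm q']quad_eta !half_rm // eq_qq.
    by case: Epos => -> -> ->.
  (* Equal bits give the narrower of two tandems a still narrower companion [q0]; three squares at
     one position then move [q0] to the right of its rightmost occurrence. *)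
  have : smaller q' by apply/hasP; exists q => //; rewrite Epos eqxx.
  rewrite -Es => /hasP[q0 q0qs /andP[/eqP Epos0 lt0]].
  have [H0 C0 M0] := rmP _ (tqs _ q0qs).
  case: (@three_tandems _ _ _ A (rm q0) (rm q) (rm q')) => //; rewrite ?half_rm //.
  - by case: Epos0.
  - by case: Epos Epos0 => <- _ _ [].
  - by case: Epos0.
  - by case: Epos Epos0 => _ <- _ [].
  - by case: Epos0.
  - by case: Epos Epos0 => _ _ <- [].
  by move=> q1 [Hq1 Cq1]; rewrite ltnNge M0 // Cq1.
rewrite -(size_map key) -(card_uniqP ukey); apply: leq_trans (max_card _) _.
by rewrite !card_prod !card_ord card_bool; lia.
Qed.

(** * Arrays and their tandems *)

Definition array_content (T : eqType) (B : array T) :=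
  let: existT d M := B in
  (d.1, d.2, mkseq (fun r => mkseq (fun c => entry M r c) d.2) d.1).

Lemma array_content_inj (T : eqType) : injective (@array_content T).
Proof.
move=> [[m n] M] [[m' n'] M'] /= [Em En E]; subst m' n'.
move/eq_mkseqP: E => E.
congr existT; apply/matrixP => i j.
have /eq_mkseqP/(_ _ (ltn_ord j)) := E _ (ltn_ord i).
by rewrite !entry_ord => -[].
Qed.

Lemma array_content_subarray (T : eqType) m n (A : 'M[T]_(m, n))
    (o : occurrence m n) :
  array_content (subarray A o) = (occ_height o, occ_width o,
    mkseq (fun r => mkseq (fun c => entry A (occ_top o + r) (occ_left o + c))
      (occ_width o)) (occ_height o)).
Proof.
case: o => t l h w rows cols /=; congr (_, _, _).
apply/eq_mkseqP => r rh; apply/eq_mkseqP => c cw.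
rewrite (@entry_ord _ _ _ _ (Ordinal rh) (Ordinal cw)) mxE.
by rewrite -entry_ord.
Qed.

(** Bridge from dependent arrays to plain quadruples. In the converse direction the left half of [B]
    serves as the root. *)
Lemma tandem_ofP (T : eqType) m n (A : 'M[T]_(m, n)) (B : array T) :
  tandem_of A B <-> exists2 q, tandem_at A q & array_content B = content A q.
Proof.
split.
  case=> -[h [w [W [h0 w0 EB]]]] [oc Eo].
  have := array_content_subarray A oc; rewrite -Eo EB /= => -[Eh Ew E].
  case: oc {Eo} => t l h' w' rows cols /= in Eh Ew E *; subst h' w'.
  move/eq_mkseqP: E => E.
  have {}E r c : r < h -> c < w + w -> entry (row_mx W W) r c = entry A (t + r) (l + c).
    by move=> rh cw; have /eq_mkseqP/(_ _ cw) := E _ rh.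
  exists (t, l, h, w); last first.
    rewrite /content /= -addnn; congr (_, _, _).
    apply/eq_mkseqP => r rh; apply/eq_mkseqP => c cw; exact: E.
  apply/tandem_atP; split=> //= [|r c rh cw]; first lia.
  rewrite -[in RHS]addnA -!E; [|lia..].
  rewrite (@entry_ord _ _ _ _ (Ordinal rh) (lshift w (Ordinal cw))).
  have -> : c + w = rshift w (Ordinal cw) by rewrite /= addnC.
  by rewrite (entry_ord _ (Ordinal rh)) row_mxEl row_mxEr.
case=> q /tandem_atP[h0 w0 tq lq Hq]; case: B => -[m' n'] M /= [Em En E].
subst m' n'; move/eq_mkseqP: E => E.
have {}E r c : r < height q -> c < (period q).*2 ->
    entry M r c = entry A (top q + r) (left q + c).
  by move=> rh cw; have /eq_mkseqP/(_ _ cw) := E _ rh.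
split; last first.
  exists (Occurrence tq lq); apply: array_content_inj.
  rewrite array_content_subarray /=; congr (_, _, _).
  by apply/eq_mkseqP => r rh; apply/eq_mkseqP => c cw; apply: E.
pose W : 'M[T]_(height q, period q) := (\matrix_(i, j) M i (cast_ord (addnn _) (lshift _ j)))%R.
exists (height q), (period q), W; split=> //; apply: array_content_inj => /=.
congr (_, _, _); first by rewrite addnn.
apply/eq_mkseqP => r rh; rewrite [X in _ = mkseq _ X]addnn.
apply/eq_mkseqP => c cw.
case: (ltnP c (period q)) => [lt_c|le_c].
  rewrite (@entry_ord _ _ _ _ (Ordinal rh) (lshift _ (Ordinal lt_c))) row_mxEl mxE.
  by rewrite -entry_ord.
have lt_c : c - period q < period q by lia.
have Ec : c = rshift (period q) (Ordinal lt_c) by rewrite /= subnKC.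
rewrite {2}Ec (entry_ord _ (Ordinal rh)) row_mxEr mxE -entry_ord /=.
rewrite !E //; last lia.
by rewrite [RHS]Hq // -addnA subnK.
Qed.

Lemma lists_distinct_tandems_of_quads (T : eqType) m n (A : 'M[T]_(m, n))
    (s : seq (array T)) (qs : seq quad) :
  map (@array_content T) s = map (content A) qs ->
  all (tandem_at A) qs -> uniq (map (content A) qs) ->
  (forall q, tandem_at A q -> content A q \in map (content A) qs) ->
  lists_distinct_tandems A s.
Proof.
move=> Es /allP tqs uqs cqs; split.
  by apply: (@map_uniq _ _ (@array_content T)); rewrite Es.
move=> B; split.
  move=> Bs; apply/tandem_ofP.
  have : array_content B \in map (content A) qs by rewrite -Es map_f.
  by case/mapP=> q /tqs; exists q.
case/tandem_ofP=> q /cqs; rewrite -Es => /mapP[B' B's ->] /array_content_inj.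
by move=> ->.
Qed.

Lemma quads_of_tandems (T : eqType) m n (A : 'M[T]_(m, n)) (s : seq (array T)) :
  (forall B, B \in s -> tandem_of A B) ->
  exists2 qs, all (tandem_at A) qs & map (@array_content T) s = map (content A) qs.
Proof.
elim: s => [|B s IH] H; first by exists [::].
have /tandem_ofP[q Hq Eq] := H B (mem_head _ _).
case: IH => [B' B's|qs Hqs Es]; first by apply: H; rewrite inE B's orbT.
by exists (q :: qs); rewrite /= ?Hq ?Eq ?Es.
Qed.

Lemma lists_distinct_tandems_le (T : eqType) n (A : 'M[T]_n) (s : seq (array T)) :
  lists_distinct_tandems A s -> size s <= 2 * n ^ 3.
Proof.
case=> us sP; have [|qs tqs Es] := @quads_of_tandems _ _ _ A s; first by move=> B /sP.
rewrite -(size_map (@array_content T)) Es size_map.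
apply: distinct_tandems_bound tqs _.
by rewrite -Es map_inj_uniq //; apply: array_content_inj.
Qed.

Lemma occurrences_of_quads (T : eqType) m n (A : 'M[T]_(m, n)) (qs : seq quad) :
  all (tandem_at A) qs -> exists os : seq (occurrence m n),
    map (@occ_code m n) os =
      [seq [:: top q; left q; height q; (period q).*2] | q <- qs] /\
    [seq array_content (subarray A o) | o <- os] = map (content A) qs.
Proof.
elim: qs => [|q qs IH] /=; first by exists [::].
case/andP=> /tandem_atP[_ _ tq lq _] /IH[os [E1 E2]].
exists (Occurrence tq lq :: os); split; first by rewrite /= E1.
by rewrite !map_cons -E2; congr (_ :: _); exact: (array_content_subarray A (Occurrence tq lq)).
Qed.

(** * An array with cubically many tandems *)

Definition row_index_mx n : 'M[nat]_n := (\matrix_(i, j) (i : nat))%R.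

Lemma row_index_mx_tandems n (s : seq (array nat)) :
  lists_distinct_tandems (row_index_mx n) s -> (n./2) ^ 3 <= size s.
Proof.
move=> [us sP]; pose m := n./2.
have le_mn : m + m <= n by rewrite /m; lia.
have Ae i j : i < n -> j < n -> entry (row_index_mx n) i j = Some i.
  by move=> ni nj; rewrite (@entry_ord _ _ _ _ (Ordinal ni) (Ordinal nj)) mxE.
(* Equal columns make the left column immaterial, so it is 0. With three parameters below [n./2] the
   tandem fits, and its corner entry reveals the top row. *)
pose q (x : 'I_m * 'I_m * 'I_m) : quad := (x.1.1 : nat, 0, x.1.2.+1, x.2.+1).
have tq x : tandem_at (row_index_mx n) (q x).
  case: x => -[i h] p; have := (ltn_ord i, ltn_ord h, ltn_ord p) => -[[li lh] lp].
  apply/tandem_atP; rewrite /q /=; split=> //; [lia|lia|].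
  by move=> r c rh cp; rewrite !Ae //; lia.
have inj_q : injective (content (row_index_mx n) \o q).
  move=> [[i h] p] [[i' h'] p'] /= /contentP[/= [Eh] [Ep] /(_ 0 0 isT isT)].
  have := (ltn_ord i, ltn_ord i', ltn_ord p) => -[[li li'] lp].
  rewrite !Ae; [|lia..] => -[]; rewrite !addn0 => Ei.
  by congr (_, _, _); apply: val_inj.
have <- : size (map (content (row_index_mx n) \o q) (enum {: 'I_m * 'I_m * 'I_m})) = m ^ 3.
  by rewrite size_map -cardT !card_prod !card_ord; lia.
rewrite -(size_map (@array_content _) s); apply: uniq_leq_size.
  by rewrite map_inj_uniq ?enum_uniq.
move=> _ /mapP[x _ ->] /=.
have [|os [_ Eos]] := @occurrences_of_quads _ _ _ (row_index_mx n) [:: q x].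
  by rewrite /= tq.
case: os Eos => [|oc os] // /(congr1 (head (0, 0, [::]))) Eo.
have {}Eo : array_content (subarray (row_index_mx n) oc) = content (row_index_mx n) (q x).
  exact: Eo.
by rewrite -Eo map_f //; apply/sP/tandem_ofP; exists (q x).
Qed.

(** * Maximum and lower bounds *)

Lemma is_Omega_of_le (f g : nat -> nat) k m : 0 < k ->
  (forall n, m <= n -> g n <= k * f n) -> is_Omega f g.
Proof.
move=> k0 H; apply/asboolP; exists (k%:R^-1)%R; first by rewrite invr_gt0 ltr0n.
exists m => // n /= mn.
rewrite [X in (_ * X <= _)%R]ger0_norm ?[X in (_ <= X)%R]ger0_norm ?ler0n //.
by rewrite ler_pdivrMl ?ltr0n // -natrM ler_nat H.
Qed.

Lemma is_Theta_of_le (f g : nat -> nat) k l m : 0 < k -> 0 < l ->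
  (forall n, m <= n -> g n <= k * f n /\ f n <= l * g n) -> is_Theta f g.
Proof.
move=> k0 l0 H; apply/asboolP; exists (k%:R^-1, l%:R)%R.
  by rewrite /= invr_gt0 !ltr0n k0 l0.
exists m => // n /= /H[H1 H2].
rewrite [`|(f n)%:R%R|%R]ger0_norm ?ler0n // [`|(g n)%:R%R|%R]ger0_norm ?ler0n //.
by rewrite ler_pdivrMl ?ltr0n // -!natrM !ler_nat.
Qed.

(** From 2 on, [n <= 4 * n./2]. *)
Lemma cube_half n : 2 <= n -> n ^ 3 <= 64 * n./2 ^ 3.
Proof. by move=> n2; rewrite -[64]/(4 ^ 3) -expnMn leq_exp2r //; lia. Qed.

(** A longest duplicate-free list of tandems, which exists by the cubic bound, is complete: a
    missing tandem could be added to it. *)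
Lemma lists_distinct_tandems_exists (T : eqType) n (A : 'M[T]_n) :
  exists s, lists_distinct_tandems A s.
Proof.
pose P k := `[< exists s : seq (array T),
  [/\ uniq s, forall B, B \in s -> tandem_of A B & size s = k] >].
have exP : exists k, P k by exists 0; apply/asboolP; exists [::].
have bP k : P k -> k <= 2 * n ^ 3.
  move/asboolP=> [s [us sP <-]]; have [qs tqs Es] := quads_of_tandems sP.
  rewrite -(size_map (@array_content T)) Es size_map.
  apply: distinct_tandems_bound tqs _.
  by rewrite -Es map_inj_uniq //; apply: array_content_inj.
case: (ex_maxnP exP bP) => k /asboolP[s [us sP Es]] mx.
exists s; split=> // B; split=> [|HB]; first exact: sP.
apply: contraT => Bs; suff: P k.+1 by move/mx; rewrite ltnn.
apply/asboolP; exists (B :: s); split; rewrite /= ?Bs ?Es // => B'.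
by rewrite inE => /predU1P[->|/sP].
Qed.

(** Although all alphabets compete, the attained counts are naturals below the common bound
    [2 * n ^ 3], so one of them is largest. *)
Lemma max_distinct_tandems_exists n : exists M, is_max_distinct_tandems n M.
Proof.
pose P k := `[< exists (T : eqType) (A : 'M[T]_n) s,
  lists_distinct_tandems A s /\ size s = k >].
have exP : exists k, P k.
  have [s sP] := lists_distinct_tandems_exists (row_index_mx n).
  by exists (size s); apply/asboolP; exists nat, (row_index_mx n), s.
have bP k : P k -> k <= 2 * n ^ 3.
  by move/asboolP=> [T [A [s [/lists_distinct_tandems_le H <-]]]].
case: (ex_maxnP exP bP) => k /asboolP kP mx; exists k; split=> // T A s sP.
by apply/mx/asboolP; exists T, A, s.
Qed.

Lemma max_distinct_tandems_bounds n M : is_max_distinct_tandems n M ->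
  n./2 ^ 3 <= M /\ M <= 2 * n ^ 3.
Proof.
case=> -[T [A [s [sP <-]]]] mx; split; last exact: lists_distinct_tandems_le sP.
have [s' s'P] := lists_distinct_tandems_exists (row_index_mx n).
by apply: leq_trans (row_index_mx_tandems s'P) (mx _ _ _ s'P).
Qed.

(** * Lower bound on the reporting time *)

Lemma exec_size_out b p s s' k :
  exec b p s s' k -> size (st_out s') <= size (st_out s) + k.
Proof. by elim=> {p s s' k} //= *; rewrite ?size_rcons; lia. Qed.

Lemma size_flatten_occ_code m n (os : seq (occurrence m n)) :
  size (flatten [seq occ_code o | o <- os]) = 4 * size os.
Proof. by elim: os => //= o os ->; rewrite !mulnS. Qed.

(** Each word of output costs at least one time unit, and the array of constant rows forces four
    words for each of its tandems. *)
Lemma reporting_time_lower_bound p c t :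
  reports_in_time p c t -> forall n, n./2 ^ 3 <= t n.
Proof.
(* One admissible word length suffices; this one works because [b < 2 ^ b]. *)
move=> H n; pose b := n.+2 ^ c.+2.
have hb : n.+2 ^ c.+2 <= 2 ^ b by apply/ltnW/ltn_expl.
have hA (i j : 'I_n) : row_index_mx n i j < 2 ^ b.
  rewrite mxE; apply: leq_trans hb; rewrite expnS.
  have := ltn_ord i; have : 0 < n.+2 ^ c.+1 by rewrite expn_gt0.
  nia.
have [s [k [Hex Hk [os [Eout Hos]]]]] := H n b (row_index_mx n) hb hA.
apply: leq_trans (row_index_mx_tandems Hos) _.
have := exec_size_out Hex; rewrite Eout size_flatten_occ_code size_map /=; lia.
Qed.

(** * Programs *)

(* The time spent before [p] is threaded through the postcondition, so that the
   running time can be part of the loop invariants. *)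
Definition wp b p s k (Q : state -> nat -> Prop) :=
  exists s' k', exec b p s s' k' /\ Q s' (k + k').

Lemma wp_conseq b p s k (Q Q' : state -> nat -> Prop) :
  wp b p s k Q -> (forall s' k', Q s' k' -> Q' s' k') -> wp b p s k Q'.
Proof. by move=> [s' [k' [H1 H2]]] H; exists s', k'; split=> //; apply: H. Qed.

Lemma wp_assign b x e s k v (Q : state -> nat -> Prop) : eval b s e = v ->
  Q (State [eta st_reg s with x |-> v] (st_mem s) (st_out s)) (k + (cost e).+1) ->
  wp b (Assign x e) s k Q.
Proof. by move=> <- H; do 2!eexists; split; first exact: ExecAssign. Qed.

Lemma wp_store b a e s k x v (Q : state -> nat -> Prop) :
  eval b s a = x -> eval b s e = v ->
  Q (State (st_reg s) [eta st_mem s with x |-> v] (st_out s))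
    (k + (cost a + cost e).+1) ->
  wp b (Store a e) s k Q.
Proof. by move=> <- <- H; do 2!eexists; split; first exact: ExecStore. Qed.

Lemma wp_output b e s k v (Q : state -> nat -> Prop) : eval b s e = v ->
  Q (State (st_reg s) (st_mem s) (rcons (st_out s) v)) (k + (cost e).+1) ->
  wp b (Output e) s k Q.
Proof. by move=> <- H; do 2!eexists; split; first exact: ExecOutput. Qed.

Lemma wp_seq b p q s k (Q : state -> nat -> Prop) :
  wp b p s k (fun s' k' => wp b q s' k' Q) -> wp b (Seq p q) s k Q.
Proof.
move=> [s1 [k1 [H1 [s2 [k2 [H2 HQ]]]]]]; exists s2, (k1 + k2).
by split; [apply: ExecSeq H1 H2|rewrite addnA].
Qed.

Lemma wp_if b e p q s k v (Q : state -> nat -> Prop) : eval b s e = v ->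
  wp b (if v != 0 then p else q) s (k + (cost e).+1) Q ->
  wp b (If e p q) s k Q.
Proof.
move=> <- [s1 [k1 [H1 HQ]]]; exists s1, (cost e + k1).+1.
by split; [apply: ExecIf|rewrite -addSn addnA].
Qed.

Lemma wp_skip b s k (Q : state -> nat -> Prop) : Q s (k + 1) -> wp b Skip s k Q.
Proof. by move=> H; do 2!eexists; split; first exact: ExecSkip. Qed.

(** The invariant is indexed by the number of completed turns; the bound [T] on this number gives
    termination. *)
Lemma wp_while b e p s k (T : nat) (I : nat -> state -> nat -> Prop)
    (Q : state -> nat -> Prop) :
  I 0 s k -> (forall t s' k', I t s' k' -> t <= T) ->
  (forall t s' k', I t s' k' -> exists2 v, eval b s' e = v &
    if v != 0 then wp b p s' (k' + (cost e).+1) (I t.+1)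
    else Q s' (k' + (cost e).+1)) ->
  wp b (While e p) s k Q.
Proof.
move=> I0 IT IS.
suff H d t s' k' : T < t + d -> I t s' k' -> wp b (While e p) s' k' Q.
  by apply: (H T.+1 0).
elim: d t s' k' => [|d IH] t s' k' lt_T It; first by have := IT _ _ _ It; lia.
have [v Ev] := IS _ _ _ It; case: (eqVneq v 0) => [Ev0|Ev0] /=.
  move=> HQ; exists s', (cost e).+1; split=> //.
  by apply: ExecWhileDone; rewrite Ev.
case=> s1 [k1 [H1 I1]]; have lt_T' : T < t.+1 + d by rewrite addSnnS.
have [s2 [k2 [H2 HQ]]] := IH _ _ _ lt_T' I1.
exists s2, (cost e + k1 + k2).+1; split.
  by apply: ExecWhileStep H1 H2; rewrite Ev.
by move: HQ; congr Q; lia.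
Qed.

(** * Evaluation without overflow and symbolic execution *)

Lemma eval_lit b s v : v < 2 ^ b -> eval b s (Lit v) = v.
Proof. exact: modn_small. Qed.

Lemma eval_reg b s x v : st_reg s x = v -> eval b s (Reg x) = v.
Proof. by []. Qed.

Lemma eval_fetch b s e a v : eval b s e = a -> st_mem s a = v ->
  eval b s (Fetch e) = v.
Proof. by move=> /= ->. Qed.

Lemma eval_add b s e1 e2 x y : eval b s e1 = x -> eval b s e2 = y ->
  x + y < 2 ^ b -> eval b s (Bin OpAdd e1 e2) = x + y.
Proof. by move=> /= -> ->; apply: modn_small. Qed.

Lemma eval_mul b s e1 e2 x y : eval b s e1 = x -> eval b s e2 = y ->
  x * y < 2 ^ b -> eval b s (Bin OpMul e1 e2) = x * y.
Proof. by move=> /= -> ->; apply: modn_small. Qed.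

Lemma eval_sub b s e1 e2 x y : eval b s e1 = x -> eval b s e2 = y ->
  y <= x -> x < 2 ^ b -> eval b s (Bin OpSub e1 e2) = x - y.
Proof.
move=> /= -> -> yx xb; rewrite /binop_eval addnC -addnBA // modnDl modn_small //; lia.
Qed.

Lemma eval_lt b s e1 e2 x y : 1 < 2 ^ b -> eval b s e1 = x -> eval b s e2 = y ->
  eval b s (Bin OpLt e1 e2) = (x < y).
Proof. by move=> b1 /= -> ->; apply: modn_small; case: (x < y) => //; lia. Qed.

Lemma eval_eq b s e1 e2 x y : 1 < 2 ^ b -> eval b s e1 = x -> eval b s e2 = y ->
  eval b s (Bin OpEq e1 e2) = (x == y).
Proof. by move=> b1 /= -> ->; apply: modn_small; case: (x == y) => //; lia. Qed.

(* [lia] does case analysis on opaque boolean hypotheses. *)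
Ltac nlia :=
  repeat match goal with
  | H : is_true ?c |- _ =>
    lazymatch c with
    | leq _ _ => fail
    | andb _ _ => fail
    | eq_op _ _ => fail
    | negb (eq_op _ _) => fail
    | negb (andb _ _) => fail
    | _ => clear H
    end
  end; lia.
Ltac ev_atom := simpl; first [eassumption | reflexivity].
Ltac ev :=
  lazymatch goal with
  | |- eval _ _ (Lit _) = _ => apply: eval_lit; try nlia
  | |- eval _ _ (Reg _) = _ => eapply eval_reg; ev_atom
  | |- eval _ _ (Fetch _) = _ => eapply eval_fetch; [ev | first [eassumption | reflexivity]]
  | |- eval _ _ (Bin OpAdd _ _) = _ => eapply eval_add; [ev | ev | try nlia]
  | |- eval _ _ (Bin OpMul _ _) = _ => eapply eval_mul; [ev | ev | try nlia]
  | |- eval _ _ (Bin OpSub _ _) = _ => eapply eval_sub; [ev | ev | try nlia | try nlia]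
  | |- eval _ _ (Bin OpLt _ _) = _ => eapply eval_lt; [try nlia | ev | ev]
  | |- eval _ _ (Bin OpEq _ _) = _ => eapply eval_eq; [try nlia | ev | ev]
  end.
Ltac wp_step :=
  cbv beta;
  lazymatch goal with
  | |- wp _ (Seq _ _) _ _ _ => apply: wp_seq; wp_step
  | |- wp _ (Assign _ _) _ _ _ => eapply wp_assign; [ev |]
  | |- wp _ (Store _ _) _ _ _ => eapply wp_store; [ev | ev |]
  | |- wp _ (Output _) _ _ _ => eapply wp_output; [ev |]
  | |- wp _ (If _ _ _) _ _ _ => eapply wp_if; [ev |]
  | |- wp _ Skip _ _ _ => apply: wp_skip
  end; cbv beta; cbn [st_reg st_mem st_out].

(** Frame condition: [l] lists the registers that may have changed. *)
Definition agree_off (l : seq nat) (f g : nat -> nat) :=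
  forall x, x \notin l -> g x = f x.

Lemma agree_off_upd l f g x v : x \in l -> agree_off l f g ->
  agree_off l f [eta g with x |-> v].
Proof. by move=> xl ag y yl /=; case: eqP yl => [->|_ /ag //]; rewrite xl. Qed.

Lemma agree_off_trans l l' f g h : all (mem l) l' -> agree_off l f g ->
  agree_off l' g h -> agree_off l f h.
Proof.
by move=> /allP sl fg gh x xl; rewrite gh ?fg //; apply: contra xl => /sl.
Qed.

Declare Scope prog_scope.
Notation "p ;; q" := (Seq p q) (at level 60, right associativity) : prog_scope.
Notation "e1 +' e2" := (Bin OpAdd e1 e2) (at level 50, left associativity) : prog_scope.
Notation "e1 -' e2" := (Bin OpSub e1 e2) (at level 50, left associativity) : prog_scope.
Notation "e1 *' e2" := (Bin OpMul e1 e2) (at level 40, left associativity) : prog_scope.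
Notation "e1 <' e2" := (Bin OpLt e1 e2) (at level 70) : prog_scope.
Notation "e1 =' e2" := (Bin OpEq e1 e2) (at level 70) : prog_scope.
Local Open Scope prog_scope.

(** [rN], [rNN] hold n and its square; [rK], [rKK], [rKKK] the powers of the bound K on names and
    nodes; [rP] the half width, [rBase] the start of the current block; [rJ], [rI] column and row.
    [rCnt] is the last number given out, [rC] a table address or a letter. In the trie, [rX] is the
    node under inspection, [rZ] the node whose link is pending, [rTop] the first row of the factor
    being reported. *)
Notation rN := 0 (only parsing).
Notation rP := 1 (only parsing).
Notation rBase := 2 (only parsing).
Notation rK := 3 (only parsing).
Notation rKK := 4 (only parsing).
Notation rKKK := 5 (only parsing).
Notation rNN := 6 (only parsing).
Notation rCnt := 7 (only parsing).
Notation rA := 8 (only parsing).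
Notation rBit := 9 (only parsing).
Notation rC := 10 (only parsing).
Notation rJ := 11 (only parsing).
Notation rI := 12 (only parsing).
Notation rCur := 13 (only parsing).
Notation rX := 14 (only parsing).
Notation rZ := 15 (only parsing).
Notation rTop := 16 (only parsing).
Notation rRun := 17 (only parsing).

(* [pre] computes, for the cell numbered by [rA], the address of a cell in [rC] and a
   bit in [rBit]. *)
Definition naming pre :=
  Assign rCnt (Lit 0) ;; Assign rA (Lit 0) ;;
  While (Reg rA <' Reg rNN)
    (pre ;;
     If (Fetch (Reg rC) =' Lit 0)
       (Assign rCnt (Reg rCnt +' Lit 1) ;; Store (Reg rC) (Reg rCnt)) Skip ;;
     Store (Reg rA) (Lit 2 *' Fetch (Reg rC) +' Reg rBit) ;;
     Assign rA (Reg rA +' Lit 1)).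

(** The new name is twice the rank of the key in order of first appearance, plus the bit. The table
    on [[lo, hi)] stores ranks, 0 meaning none yet. Renaming is in place: [pre] may read cells [a]
    and [a.+1] because neither has been overwritten at turn [a]. *)
Lemma naming_spec b pre N lo hi tpre (key bit m0 : nat -> nat) s k :
  st_reg s rNN = N -> 2 * N + 1 < 2 ^ b -> N < lo -> hi <= 2 ^ b ->
  (forall a, st_mem s a = m0 a) ->
  (forall x, lo <= x < hi -> m0 x = 0) ->
  (forall a, a < N -> lo <= key a < hi /\ bit a <= 1) ->
  (forall a s' k', a < N -> agree_off [:: rCnt; rA; rBit; rC] (st_reg s) (st_reg s') ->
    st_reg s' rA = a -> st_mem s' a = m0 a -> st_mem s' a.+1 = m0 a.+1 ->
    wp b pre s' k' (fun s1 k1 => [/\ agree_off [:: rBit; rC] (st_reg s') (st_reg s1),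
      st_reg s1 rC = key a, st_reg s1 rBit = bit a, st_mem s1 = st_mem s' &
      st_out s1 = st_out s' /\ k1 <= k' + tpre])) ->
  wp b (naming pre) s k (fun s' k' =>
    [/\ agree_off [:: rCnt; rA; rBit; rC] (st_reg s) (st_reg s') /\
     st_out s' = st_out s,
     forall a, a < N -> st_mem s' a <= 2 * N + 1,
     forall a a', a < N -> a' < N ->
       (st_mem s' a = st_mem s' a' <-> key a = key a' /\ bit a = bit a'),
     forall x, N <= x -> ~~ (lo <= x < hi) -> st_mem s' x = m0 x &
     k' <= k + (tpre + 40) * N.+1]).
Proof.
move=> rNN_ NW Nlo hiW Em zero keyP preP.
have W1 : 1 < 2 ^ b by lia.
rewrite /naming; do 2!wp_step.
(* Nonzero table cells hold distinct ranks bounded by the counter; cells from [t] on outside the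
   table still have their old values. *)
pose I t s' k' := [/\ t <= N, agree_off [:: rCnt; rA; rBit; rC] (st_reg s) (st_reg s') /\
  st_out s' = st_out s, st_reg s' rA = t,
  [/\ forall a, a < t -> 0 < st_mem s' (key a) /\
        st_mem s' a = 2 * st_mem s' (key a) + bit a,
     forall x, t <= x -> ~~ (lo <= x < hi) -> st_mem s' x = m0 x,
     forall x, lo <= x < hi -> st_mem s' x <= st_reg s' rCnt,
     forall x y, lo <= x < hi -> lo <= y < hi -> 0 < st_mem s' x ->
       st_mem s' x = st_mem s' y -> x = y &
     st_reg s' rCnt <= t] & k' <= k + 10 + (tpre + 36) * t].
apply: (@wp_while _ _ _ _ _ N I) => [|t s' k' []|t s' k'] //.
  split=> //=; last lia.
    by split=> //; do !apply: agree_off_upd.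
  split=> //.
  - by move=> x Hx; rewrite Em zero.
  - by move=> x y Hx; rewrite Em zero.
case=> tN [ag out] rA_ [M1 M2 M3 M4 M5] time.
have rNN' : st_reg s' rNN = N by rewrite ag.
eexists; first ev.
case: (ltnP t N) => [lt_tN|le_Nt] /=; last first.
  have lt_t a : a < N -> a < t by lia.
  split=> //.
  - move=> a aN; have [_ ->] := M1 _ (lt_t _ aN); have [/M3] := keyP _ aN; lia.
  - move=> a a' aN a'N; have [p1 ->] := M1 _ (lt_t _ aN).
    have [p2 ->] := M1 _ (lt_t _ a'N).
    have [k1 b1] := keyP _ aN; have [k2 b2] := keyP _ a'N.
    split=> [E|[-> ->] //]; split; last lia.
    by apply: M4 => //; lia.
  - by move=> x Nx; apply: M2; lia.
  - by nia.
apply: wp_seq; apply: wp_conseq.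
  apply: (preP t) => //.
  - by apply: M2 => //; lia.
  - by apply: M2; lia.
move=> s1 k1 [ag1 rC1 rB1 mem1 [out1 time1]].
have [key_t bit_t] := keyP _ lt_tN.
have rA1 : st_reg s1 rA = t by rewrite ag1.
have EC : st_reg s1 rCnt = st_reg s' rCnt by rewrite ag1.
set cnt := st_reg s' rCnt in EC M3 M5.
have le_cnt := M3 _ key_t.
have keyN a : a < N -> key a != t by move=> /keyP[]; lia.
apply: wp_seq; wp_step.
(* The end of the loop body, shared by the cases of a new and of a known key. *)
have finish cnt' s2 k2 :
    agree_off [:: rCnt; rA; rBit; rC] (st_reg s) (st_reg s2) ->
    st_reg s2 rA = t -> st_reg s2 rC = key t -> st_reg s2 rBit = bit t ->
    st_reg s2 rCnt = cnt' -> st_out s2 = st_out s ->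
    cnt' <= t.+1 -> 0 < st_mem s2 (key t) ->
    (forall x, x != key t -> st_mem s2 x = st_mem s' x) ->
    (forall x, lo <= x < hi -> st_mem s2 x <= cnt') ->
    (forall x y, lo <= x < hi -> lo <= y < hi -> 0 < st_mem s2 x ->
       st_mem s2 x = st_mem s2 y -> x = y) ->
    (forall x, 0 < st_mem s' x -> st_mem s2 x = st_mem s' x) ->
    k2 <= k1 + 20 ->
    wp b (Store (Reg rA) (Lit 2 *' Fetch (Reg rC) +' Reg rBit) ;;
          Assign rA (Reg rA +' Lit 1)) s2 k2 (I t.+1).
  move=> ag2 rA2 rC2 rB2 cnt2 out2 cnt'_le pos2 off2 le2 inj2 mon2 time2.
  have le_key := le2 _ key_t.
  do 2!wp_step; split=> //=; last lia.
    by split=> //; apply: agree_off_upd.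
    by rewrite addn1.
  rewrite cnt2; split=> //.
  - move=> a; rewrite ltnS leq_eqVlt => /predU1P[->|lt_at].
      by rewrite (negPf (keyN _ lt_tN)) eqxx.
    have aN : a < N by lia.
    rewrite (negPf (keyN _ aN)); have -> : (a == t) = false by lia.
    have [p0 E0] := M1 _ lt_at.
    rewrite mon2 //; split=> //; rewrite off2 //; have [] := keyP _ lt_tN; lia.
  - move=> x tx Hx; have -> : (x == t) = false by lia.
    rewrite off2; first by apply: M2 => //; lia.
    by apply: contra Hx => /eqP->.
  - move=> x Hx; have -> : (x == t) = false by lia.
    exact: le2.
  - move=> x y Hx Hy; have -> : (x == t) = false by lia.
    have -> : (y == t) = false by lia.
    exact: inj2.
case: (eqVneq (st_mem s1 (key t)) 0) => [E0|E0] /=.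
- rewrite mem1 in E0; do 2!wp_step.
  apply: (finish cnt.+1) => //=; rewrite ?mem1 ?eqxx ?addn1 //; try lia.
  + by apply: agree_off_upd => //; apply: agree_off_trans ag1.
  + by rewrite out1.
  + by move=> x /negPf->.
  + by move=> x Hx; case: eqP => // _; apply: leqW; apply: M3.
  + move=> x y Hx Hy; have [Lx Ly] := (M3 x Hx, M3 y Hy).
    by do 2!case: eqP => [->|_] //; [lia..|apply: M4].
  + by move=> x; case: eqP => // ->; rewrite E0.
- rewrite mem1 in E0; wp_step.
  apply: (finish cnt) => //=; rewrite ?mem1 ?out1 //; try lia.
  by apply: agree_off_trans ag1.
Qed.

(** * Suffix tries *)

(* Trie nodes are words; the node number of a word is its rank in the list of
   all nodes, counted from 1, so that 0 means "no such node". *)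
Definition node (F : seq (seq nat)) (u : seq nat) := if u \in F then (index u F).+1 else 0.

Lemma node_eq0 (F : seq (seq nat)) u : (node F u == 0) = (u \notin F).
Proof. by rewrite /node; case: (u \in F). Qed.

Lemma node_le F u : node F u <= size F.
Proof. by rewrite /node; case: ifP => //; rewrite index_mem. Qed.

Lemma node_inj (F : seq (seq nat)) u v : u \in F -> node F u = node F v -> u = v.
Proof.
rewrite /node => uF; rewrite uF; case: ifP => // vF [E].
by rewrite -(nth_index [::] uF) E nth_index.
Qed.

Lemma node_rcons (F : seq (seq nat)) v u : v \notin F ->
  node (rcons F v) u = if u == v then (size F).+1 else node F u.
Proof.
rewrite /node mem_rcons inE -cats1 index_cat /= => vF.
case: (eqVneq u v) => [->|uv] /=; first by rewrite (negPf vF) ?eqxx addn0.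
by case: (u \in F).
Qed.

(** Row [x] of a table of width [K] lists the children of node [x] by letter. Rows of numbers not
    yet given out are zero, so a new node needs no initialisation. *)
Definition has_children B K (F : seq (seq nat)) (m : nat -> nat) :=
  (forall (u : seq nat) c, u \in F -> c < K -> m (B + (node F u * K + c)) = node F (rcons u c)) /\
  (forall x c, size F < x -> x < K -> c < K -> m (B + (x * K + c)) = 0).

Lemma key_lt K x c : x < K -> c < K -> x * K + c < K * K.
Proof.
by move=> xK cK; apply: (@leq_trans (x.+1 * K)); rewrite ?leq_mul2r ?xK ?orbT //; lia.
Qed.

Lemma key_inj K x c y d : c < K -> d < K -> x * K + c = y * K + d -> x = y /\ c = d.
Proof.
move=> cK dK E; have K0 : 0 < K by lia.
have := congr1 (modn^~ K) E; have := congr1 (divn^~ K) E.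
by rewrite !divnMDl // !modnMDl !modn_small // !divn_small // !addn0.
Qed.

(** Row 0 is exempt: [push] writes its sentinel edges there. *)
Lemma has_children_agree B K (F : seq (seq nat)) m m' : size F < K ->
  (forall x c, 0 < x -> x < K -> c < K -> m' (B + (x * K + c)) = m (B + (x * K + c))) ->
  has_children B K F m -> has_children B K F m'.
Proof.
move=> FK E [H1 H2]; split=> [u c uF cK|x c Fx xK cK].
  rewrite E ?H1 // ?lt0n ?node_eq0 ?negbK //.
  by apply: leq_ltn_trans FK; apply: node_le.
by rewrite E ?H2 //; lia.
Qed.

Lemma has_children_add B K (F : seq (seq nat)) m (u : seq nat) c : u \in F -> c < K -> rcons u c \notin F ->
  (size F).+1 < K -> (forall (v : seq nat) d, rcons v d \in F -> v \in F) ->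
  has_children B K F m ->
  has_children B K (rcons F (rcons u c))
    [eta m with B + (node F u * K + c) |-> (size F).+1].
Proof.
move=> uF cK ucF FK pF [H1 H2].
have le_node := node_le F u.
have uF0 : 0 < node F u by rewrite lt0n node_eq0 uF.
split=> [v d vF dK|x d /=]; last first.
  rewrite size_rcons => Fx xK dK.
  have /negPf-> : B + (x * K + d) != B + (node F u * K + c).
    by apply/eqP => /addnI/(key_inj dK cK)[]; lia.
  by apply: H2 => //; lia.
rewrite !node_rcons //.
have Euc : (v \in F) -> (B + (node F v * K + d) == B + (node F u * K + c)) =
    (rcons v d == rcons u c).
  move=> vF'; apply/eqP/eqP => [|/rcons_inj[-> ->]] //.
  by move=> /addnI/(key_inj dK cK)[/node_inj-> // ->].
case: (eqVneq v (rcons u c)) => [Ev|Nv] /=.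
  have /negPf-> : B + ((size F).+1 * K + d) != B + (node F u * K + c).
    by apply/eqP => /addnI/(key_inj dK cK)[]; lia.
  have -> : (rcons v d == rcons u c) = false.
    by apply/negP => /eqP/rcons_inj[E _]; rewrite -E Ev in ucF; have := congr1 size Ev;
      rewrite -E size_rcons; lia.
  (* Prefix closure: an extension of the new word among the nodes would have made the word itself a
     node. *)
  rewrite H2 //; apply/esym/eqP; rewrite node_eq0.
  by apply: contra ucF => /pF; rewrite Ev.
have vF' : v \in F by move: vF; rewrite mem_rcons inE (negPf Nv).
by rewrite Euc //; case: ifP => // _; rewrite H1.
Qed.

(** Deleting the first or the last letter generates all factors. *)
Definition factor_closed (F : seq (seq nat)) :=
  forall u : seq nat, u \in F -> behead u \in F /\ forall (v : seq nat) c, u = rcons v c -> v \in F.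

(** The words that [push] creates, longest first, in its first [t] turns. *)
Definition ext (w : seq nat) c t := [seq rcons (drop l w) c | l <- iota 0 t].

Lemma extS w c t : ext w c t.+1 = rcons (ext w c t) (rcons (drop t w) c).
Proof. by rewrite /ext -[t.+1]addn1 iotaD map_cat /= add0n cats1. Qed.

Lemma mem_drop_closed (F : seq (seq nat)) w t : factor_closed F -> w \in F -> drop t w \in F.
Proof.
move=> cF wF; elim: t => [|t IH]; first by rewrite drop0.
by rewrite -add1n -drop_drop drop1; case: (cF _ IH).
Qed.

Lemma ext_prefix (F : seq (seq nat)) w c t : factor_closed F -> w \in F ->
  forall (v : seq nat) d, rcons v d \in F ++ ext w c t -> v \in F.
Proof.
move=> cF wF v d; rewrite mem_cat => /orP[/cF[_ /(_ v d erefl)] //|].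
by case/mapP=> l _ /rcons_inj[-> _]; apply: mem_drop_closed.
Qed.

Lemma behead_ext (w : seq nat) c l : l < size w ->
  behead (rcons (drop l w) c) = rcons (drop l.+1 w) c.
Proof. by move=> lw; rewrite (drop_nth 0 lw). Qed.

(* [t] is the first suffix of [w] (numbered by its start) whose extension by
   [c] was there before, or [(size w).+1] if there is none. *)
Lemma ext_closed (F : seq (seq nat)) w c t : factor_closed F -> w \in F -> [::] \in F ->
  t <= (size w).+1 -> (t <= size w -> rcons (drop t w) c \in F ++ ext w c t) ->
  factor_closed (F ++ ext w c t) /\ rcons w c \in F ++ ext w c t.
Proof.
move=> cF wF nF tw Ht; split=> [u|].
  rewrite mem_cat => /orP[/cF[H1 H2]|/mapP[l]].
    by split=> [|v d Ev]; rewrite mem_cat ?H1 // (H2 _ _ Ev).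
  rewrite mem_iota add0n => /andP[_ lt_lt] ->; split; last first.
    by move=> v d /rcons_inj[<- _]; rewrite mem_cat mem_drop_closed.
  case: (ltnP l (size w)) => [lw|wl]; last first.
    by rewrite (drop_oversize wl) mem_cat nF.
  rewrite behead_ext //.
  case: (ltnP l.+1 t) => lt; last first.
    have -> : l.+1 = t by lia.
    by apply: Ht; lia.
  by rewrite mem_cat [X in _ || X]map_f ?orbT // mem_iota.
case: (posnP t) => [t0|t0]; first by move: Ht; rewrite t0 drop0; apply.
by rewrite mem_cat -{2}(drop0 w) [X in _ || X](map_f (fun l => rcons (drop l w) c))
  ?orbT // mem_iota.
Qed.

Definition child_addr r := Reg rBase +' (Reg r *' Reg rK +' Reg rC).
Definition link_addr r := Reg rBase +' Lit 2 *' Reg rKK +' Reg r.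

(** Only the word created last may lack the target of its suffix link. *)
Lemma ext_behead (F : seq (seq nat)) w c t u : factor_closed F -> [::] \in F ->
  t <= (size w).+1 -> u \in F ++ ext w c t ->
  (t == 0) || (u != rcons (drop t.-1 w) c) -> behead u \in F ++ ext w c t.
Proof.
move=> cF nF tw; rewrite mem_cat => /orP[/cF[H _] _|]; first by rewrite mem_cat H.
case/mapP=> l; rewrite mem_iota add0n => /andP[_ lt_lt] -> Hl.
have lt1 : l.+1 < t.
  rewrite ltn_neqAle lt_lt andbT; apply/eqP => El.
  by move: Hl; rewrite -El /= eqxx.
rewrite behead_ext; last lia.
by rewrite mem_cat [X in _ || X](map_f (fun l => rcons (drop l w) c)) ?orbT // mem_iota.
Qed.

(* Appends the letter in [rC] to the current word, whose node is [rCur], and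
   reports every factor that is new.  Node 1 is the empty word.  Node 0 acts as
   its suffix link, with an edge to node 1 for every letter, so that the loop
   stops at the root without a test; the link stored at 0 on the first turn is
   never read. *)
Definition push :=
  Store (Reg rBase +' Reg rC) (Lit 1) ;;
  Assign rX (Reg rCur) ;; Assign rZ (Lit 0) ;; Assign rTop (Reg rRun) ;;
  While (Fetch (child_addr rX) =' Lit 0)
    (Assign rCnt (Reg rCnt +' Lit 1) ;;
     Store (child_addr rX) (Reg rCnt) ;;
     Store (link_addr rZ) (Reg rCnt) ;;
     Assign rZ (Reg rCnt) ;;
     Output (Reg rTop) ;; Output (Reg rJ) ;;
     Output (Reg rI +' Lit 1 -' Reg rTop) ;; Output (Lit 2 *' Reg rP) ;;
     Assign rX (Fetch (link_addr rX)) ;;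
     Assign rTop (Reg rTop +' Lit 1)) ;;
  Store (link_addr rZ) (Fetch (child_addr rX)) ;;
  Assign rCur (Fetch (child_addr rCur)).

(** The link of the root is node 0. [P] exempts words whose link is still to be written. *)
Definition has_links L (F : seq (seq nat)) (m : nat -> nat) (P : pred (seq nat)) :=
  m (L + 1) = 0 /\
  forall u : seq nat, u \in F -> u != [::] -> P u -> m (L + node F u) = node F (behead u).

Definition trie_code run i j p t :=
  flatten [seq [:: run + l; j; i.+1 - (run + l); p.*2] | l <- iota 0 t].

Lemma trie_codeS run i j p t : trie_code run i j p t.+1 =
  trie_code run i j p t ++ [:: run + t; j; i.+1 - (run + t); p.*2].
Proof. by rewrite /trie_code -[t.+1]addn1 iotaD map_cat flatten_cat add0n. Qed.

(** By closure under factors, once one suffix of the extended word is known all shorter ones are, so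
    the loop may stop there. Each turn creates and reports one factor, hence time linear in [t.+1].
    The capacity hypothesis concerns only duplicate-free node lists, to which the bound on distinct
    tandems will apply. *)
Lemma push_spec b B K KK (F : seq (seq nat)) w c run i j p s k :
  (forall x d, x < K -> d < K -> x * K + d < KK) -> K + K <= KK ->
  B + 3 * KK <= 2 ^ b -> 2 < K -> i.+1 < 2 ^ b -> p.*2 < 2 ^ b ->
  st_reg s rBase = B -> st_reg s rK = K -> st_reg s rKK = KK ->
  st_reg s rC = c -> st_reg s rCur = node F w -> st_reg s rRun = run ->
  st_reg s rI = i -> st_reg s rJ = j -> st_reg s rP = p -> st_reg s rCnt = size F ->
  run + size w = i -> uniq F -> node F [::] = 1 -> factor_closed F -> w \in F -> c < K ->
  (forall t, t <= (size w).+1 -> uniq (F ++ ext w c t) -> size F + t < K) ->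
  has_children B K F (st_mem s) -> has_links (B + 2 * KK) F (st_mem s) predT ->
  wp b push s k (fun s' k' => exists t,
    [/\ t <= (size w).+1,
     [/\ uniq (F ++ ext w c t), factor_closed (F ++ ext w c t),
         rcons w c \in F ++ ext w c t,
         has_children B K (F ++ ext w c t) (st_mem s') &
         has_links (B + 2 * KK) (F ++ ext w c t) (st_mem s') predT],
     [/\ agree_off [:: rCnt; rCur; rX; rZ; rTop] (st_reg s) (st_reg s'),
         st_reg s' rCnt = size F + t,
         st_reg s' rCur = node (F ++ ext w c t) (rcons w c) &
         st_out s' = st_out s ++ trie_code run i j p t],
     forall x, ~~ (B <= x < B + KK) -> ~~ (B + 2 * KK <= x < B + 2 * KK + K) ->
       st_mem s' x = st_mem s x &
     k' <= k + 100 * t.+1]).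
Proof.
move=> keyKK KK2 BW K2 iW pW EB EK EKK EC ECur ERun EI EJ EP ECnt Ei uF F1 cF wF cK FK hD hL.
have nF : [::] \in F by rewrite -[_ \in _]negbK -node_eq0 F1.
have FK0 : size F < K by have := FK 0 isT; rewrite cats0 addn0; apply.
have W1 : 1 < 2 ^ b by nlia.
have cKK : c < KK by nlia.
rewrite /push /child_addr /link_addr; do 4!wp_step.
pose Ft t := F ++ ext w c t.
have sFt t : size (Ft t) = size F + t by rewrite size_cat size_map size_iota.
have nodeF t (u : seq nat) : u \in F -> node (Ft t) u = node F u.
  by move=> uF'; rewrite /node mem_cat uF' /= index_cat uF'.
(* The node inspected at turn [t]: the suffix from [t] on, and 0 once past the root. *)
pose xt t := if t <= size w then node F (drop t w) else 0.
pose L := B + 2 * KK.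
pose zt t := if t is 0 then 0 else size F + t.
(* The link of the most recent word waits for the next turn or the end of the loop, hence the
   exempted word. *)
pose I t s' k' := [/\ t <= (size w).+1 /\ uniq (Ft t),
  [/\ agree_off [:: rCnt; rX; rZ; rTop] (st_reg s) (st_reg s'),
      st_reg s' rCnt = size F + t, st_reg s' rX = xt t /\ st_reg s' rTop = run + t,
      st_reg s' rZ = zt t &
      st_out s' = st_out s ++ trie_code run i j p t],
  [/\ st_mem s' (B + c) = 1, has_children B K (Ft t) (st_mem s') &
      has_links L (Ft t) (st_mem s')
       (fun u => (t == 0) || (u != rcons (drop t.-1 w) c))],
  forall x, ~~ (B <= x < B + KK) -> ~~ (L <= x < L + K) -> st_mem s' x = st_mem s x &
  k' <= k + 50 + 70 * t].
have xtK t : xt t < K.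
  by rewrite /xt; case: ifP => _; [apply: leq_ltn_trans (node_le _ _) FK0|nlia].
apply: wp_seq; apply: (@wp_while _ _ _ _ _ (size w).+1 I) => [|t s' k' [] []|t s' k'] //.
  split=> /=; last nlia.
  - by rewrite /Ft cats0.
  - split=> //; last by rewrite cats0.
    + by do !apply: agree_off_upd => //.
    + by rewrite addn0.
    + by rewrite /xt drop0 addn0.
  - split; first by rewrite eqxx.
      rewrite /Ft cats0; apply: has_children_agree hD => // x d x0 xK dK /=.
      have /negPf-> // : B + (x * K + d) != B + c.
      by rewrite eqn_add2l; apply/eqP => /(key_inj (x := x) (y := 0) dK cK)[]; nlia.
    rewrite /Ft cats0; case: hL => hL1 hL2; split=> /=.
      have /negPf-> // : L + 1 != B + c by rewrite /L; nlia.
    move=> u uF' u0 _; have /negPf-> : L + node F u != B + c by rewrite /L; nlia.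
    exact: hL2.
  - move=> x Bx _; have /negPf-> // : x != B + c by nlia.
case=> -[tw uFt] [ag rCnt' [rX' rTop'] rZ' out'] [m1 hD' hL'] off time.
have xtK' := xtK t.
have key_lt' := keyKK _ _ xtK' cK.
have EB' : st_reg s' rBase = B by rewrite ag.
have EK' : st_reg s' rK = K by rewrite ag.
have EKK' : st_reg s' rKK = KK by rewrite ag.
have EC' : st_reg s' rC = c by rewrite ag.
have ECur' : st_reg s' rCur = node F w by rewrite ag.
have EI' : st_reg s' rI = i by rewrite ag.
have EJ' : st_reg s' rJ = j by rewrite ag.
have EP' : st_reg s' rP = p by rewrite ag.
have FtK := FK t tw uFt.
clear EB EK EKK EC ECur EI EJ EP ECnt.
(* The 1 is the sentinel edge from node 0 to the root. *)
pose v := if t <= size w then node (Ft t) (rcons (drop t w) c) else 1.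
have child_t : st_mem s' (B + (xt t * K + c)) = v.
  rewrite /v /xt; case: ifP => // tw'.
  have dF := mem_drop_closed t cF wF.
  rewrite -(nodeF t) //; case: hD' => -> //.
  by rewrite mem_cat dF.
have F0 : 0 < size F by case: (F) nF.
have ztK : zt t < K by rewrite /zt; case: (t) FtK => //; nlia.
have zt1 : zt t != 1 by rewrite /zt; case: (t); nlia.
have zt_old (u : seq nat) : u \in F -> node F u != zt t.
  move=> uF'; have := node_le F u; have : node F u != 0 by rewrite node_eq0 uF'.
  by rewrite /zt; case: (t); nlia.
have node_last : 0 < t -> node (Ft t) (rcons (drop t.-1 w) c) = zt t.
  case: (t) tw uFt => // t1 tw1; rewrite /Ft extS -rcons_cat rcons_uniq /zt /= => /andP[H _].
  by rewrite node_rcons // eqxx size_cat size_map size_iota addnS.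
have zt_node (u : seq nat) : u \in Ft t -> (t == 0) || (u != rcons (drop t.-1 w) c) ->
    node (Ft t) u != zt t.
  move=> uFt' Hu; case: (posnP t) => [t0|t0].
    by rewrite t0 /= -lt0n lt0n node_eq0 -t0 uFt'.
  rewrite -node_last //; apply/eqP => /(node_inj uFt') Eu.
  by move: Hu; rewrite Eu eqxx; nlia.
eexists; first ev.
have wK := leq_ltn_trans (node_le F w) FK0.
have key_w := keyKK _ _ wK cK.
have closed_F := ext_closed cF wF nF tw.
case: (eqVneq v 0) => [v0|v0] /=; last first.
  do 2!wp_step.
  have newF : t <= size w -> rcons (drop t w) c \in Ft t.
    by move=> tw'; rewrite -[_ \in _]negbK -node_eq0; move: v0; rewrite /v tw'.
  have [cF' wF'] := closed_F c newF; exists t; split=> //=.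
  - split=> //.
      apply: has_children_agree hD' => [|x d x0 xK dK /=]; first by rewrite sFt.
      have := keyKK _ _ xK dK => ?.
      by have /negPf-> : B + (x * K + d) != L + zt t by rewrite /L; nlia.
    case: hL' => hL1 hL2; split=> [|u uFt' u0 _] /=.
      by have /negPf-> : L + 1 != L + zt t by nlia.
    rewrite eqn_add2l.
    case: (boolP ((t == 0) || (u != rcons (drop t.-1 w) c))) => Hu.
      by rewrite (negPf (zt_node _ uFt' Hu)) hL2.
    have t0 : 0 < t by case: (t) Hu.
    have {Hu uFt' u0} -> : u = rcons (drop t.-1 w) c.
      by apply/eqP; move: Hu; case: (t) t0 => //= t1 _ /negbNE.
    rewrite node_last // eqxx /v; case: (leqP t (size w)) => [tw'|wt].
      by rewrite behead_ext ?prednK //; nlia.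
    by rewrite drop_oversize ?(nodeF _ [::]) //; nlia.
  - split=> //.
      by apply: agree_off_upd => //; apply: agree_off_trans ag.
    have /negPf-> : B + (node F w * K + c) != L + zt t by rewrite /L; nlia.
    rewrite -(nodeF t w) //; case: hD' => -> //.
    by rewrite mem_cat wF.
  - move=> x Bx Lx; have /negPf-> : x != L + zt t by rewrite /L; nlia.
    exact: off.
  - by nlia.
move: v0; rewrite /v; case: (leqP t (size w)) => // {}tw /eqP; rewrite node_eq0 => newF.
set new := rcons (drop t w) c in newF.
have dF : drop t w \in F by apply: mem_drop_closed.
have xtE : xt t = node F (drop t w) by rewrite /xt tw.
have xt0 : 0 < xt t by rewrite xtE lt0n node_eq0 dF.
have xtF : xt t <= size F by rewrite xtE node_le.
have EFt1 : Ft t.+1 = rcons (Ft t) new by rewrite /Ft extS -rcons_cat.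
have uFt1 : uniq (Ft t.+1) by rewrite EFt1 rcons_uniq newF.
have FtK1 : size F + t.+1 < K by apply: FK.
do 10!wp_step.
have a12 : B + 2 * KK + zt t != B + (xt t * K + c) by nlia.
split=> /=; last by nlia.
- by split.
- split=> //=.
  + by do !apply: agree_off_upd => //.
  + nlia.
  + split; last nlia.
    have /negPf-> : B + 2 * KK + xt t != B + 2 * KK + zt t.
      by rewrite eqn_add2l xtE zt_old.
    have /negPf-> : B + 2 * KK + xt t != B + (xt t * K + c) by nlia.
    (* From the root the link leads to node 0, where the next test ends the loop. *)
    case: hL' => hL1 hL2; case: (eqVneq (drop t w) [::]) => [E|NE].
      have := congr1 size E; rewrite size_drop /= => E0.
      by rewrite xtE E F1 hL1 /xt; case: leqP => //; nlia.
    have tlw : t < size w by rewrite ltnNge; apply: contra NE => H; rewrite drop_oversize.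
    rewrite xtE -(nodeF t _ dF) hL2 ?mem_cat ?dF //; last first.
      case: (posnP t) => //= t0; apply/eqP => /(congr1 size).
      by rewrite size_rcons !size_drop; nlia.
    rewrite /xt tlw -drop1 drop_drop add1n nodeF //.
    exact: mem_drop_closed.
  + rewrite /zt; nlia.
  + rewrite out' trie_codeS -!cats1 -!catA /=; congr (_ ++ (_ ++ [:: _; _; _; _])); nlia.
- split.
  + have /negPf-> : B + c != B + 2 * KK + zt t by nlia.
    have /negPf-> // : B + c != B + (xt t * K + c).
    rewrite eqn_add2l; apply/eqP => /(key_inj (x := 0) cK cK)[]; nlia.
  + rewrite EFt1; apply: (@has_children_agree _ _ _
      [eta st_mem s' with B + (node (Ft t) (drop t w) * K + c) |-> (size (Ft t)).+1]).
    * by rewrite size_rcons sFt -addnS.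
    * move=> x d x0 xK dK /=; have := keyKK _ _ xK dK => ?.
      have /negPf-> : B + (x * K + d) != B + 2 * KK + zt t by nlia.
      by rewrite nodeF // -xtE sFt addn1.
    * apply: has_children_add => //; rewrite ?sFt ?mem_cat ?dF //; first nlia.
      by move=> v' d /(ext_prefix cF wF) vF; rewrite mem_cat vF.
  + have Lz x : B + 2 * KK + x != B + (xt t * K + c) by nlia.
    case: hL' => hL1 hL2; split=> [|u].
      by rewrite /= eqn_add2l [1 == _]eq_sym (negPf zt1) (negPf (Lz 1)).
    rewrite /= EFt1 mem_rcons inE -/new => + u0 Nu; rewrite (negPf Nu) /= => uFt'.
    rewrite eqn_add2l (negPf (Lz _)) node_rcons // (negPf Nu).
    case: (boolP ((t == 0) || (u != rcons (drop t.-1 w) c))) => Hu.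
      rewrite (negPf (zt_node _ uFt' Hu)) hL2 // node_rcons //.
      have /negPf-> // : behead u != new.
      by apply: contra newF => /eqP <-; apply: ext_behead Hu => //; nlia.
    have t0 : 0 < t by case: (t) Hu.
    have -> : u = rcons (drop t.-1 w) c by apply/eqP; move: Hu; case: (t) t0 => //= t1 _ /negbNE.
    by rewrite node_last // eqxx behead_ext ?prednK // node_rcons // eqxx sFt addn1.
- move=> x Bx Lx; have /negPf-> : x != B + 2 * KK + zt t by rewrite /L in Lx; nlia.
  have /negPf-> : x != B + (xt t * K + c) by nlia.
  exact: off.
Qed.

(** * Tandems of one width *)

(** The trie stores this word; for tandems of one width it stands for the content. *)
Definition names (R : nat -> nat) n (q : quad) : seq nat :=
  [seq R (r * n + left q) | r <- iota (top q) (height q)].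

Definition named_tandem (R : nat -> nat) n p (q : quad) :=
  [&& period q == p, 0 < height q, top q + height q <= n, left q + p.*2 <= n &
   all (fun r => R (r * n + left q) == R (r * n + left q + p))
     (iota (top q) (height q))].

Definition quads_code (qs : seq quad) :=
  flatten [seq [:: top q; left q; height q; (period q).*2] | q <- qs].

Definition suffix_quads run i j p t : seq quad :=
  [seq (run + l, j, i.+1 - (run + l), p) | l <- iota 0 t].

Lemma quads_code_cat qs qs' : quads_code (qs ++ qs') = quads_code qs ++ quads_code qs'.
Proof. by rewrite /quads_code map_cat flatten_cat. Qed.

Lemma quads_code_suffix run i j p t :
  quads_code (suffix_quads run i j p t) = trie_code run i j p t.
Proof. by rewrite /quads_code /suffix_quads -map_comp. Qed.

Lemma ext_names R n run i j p t : run <= i -> t <= (i - run).+1 ->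
  ext (names R n (run, j, i - run, p)) (R (i * n + j)) t =
  map (names R n) (suffix_quads run i j p t).
Proof.
move=> ri ti; rewrite /ext /suffix_quads -map_comp; apply/eq_in_map => l.
rewrite mem_iota add0n => /andP[_ lt]; rewrite /names /= -map_drop drop_iota.
have -> : i.+1 - (run + l) = i - run - l + 1 by lia.
rewrite iotaD map_cat cats1 /= addnC; congr (rcons _ (R (_ * n + j))); lia.
Qed.

Lemma named_tandem_suffix R n run i j p t : i < n -> j + p.*2 <= n ->
  (forall r, run <= r -> r <= i -> R (r * n + j) = R (r * n + j + p)) ->
  run <= i -> t <= (i - run).+1 ->
  all (named_tandem R n p) (suffix_quads run i j p t).
Proof.
move=> ni jn sq ri ti; apply/allP => q /mapP[l]; rewrite mem_iota add0n => /andP[_ lt] ->.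
rewrite /named_tandem /= eqxx jn; apply/and4P; split=> //; [lia|lia|].
by apply/allP => r; rewrite mem_iota => Hr; apply/eqP/sq; lia.
Qed.

(** Nodes are numbered in the order of reporting, after the root, so distinct nodes mean distinct
    reports. *)
Definition trie_nodes R n (qs : seq quad) := [::] :: map (names R n) qs.

Lemma size_trie_nodes R n qs : size (trie_nodes R n qs) = (size qs).+1.
Proof. by rewrite /= size_map. Qed.

Lemma uniq_trie_nodes R n qs :
  uniq (trie_nodes R n qs) -> uniq (map (names R n) qs).
Proof. by rewrite /trie_nodes cons_uniq => /andP[]. Qed.

Definition trie_state B K KK R n (qs : seq quad) s :=
  [/\ uniq (trie_nodes R n qs), factor_closed (trie_nodes R n qs),
     has_children B K (trie_nodes R n qs) (st_mem s),
     has_links (B + 2 * KK) (trie_nodes R n qs) (st_mem s) predT &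
     st_reg s rCnt = (size qs).+1].

(* [rRun] is the first row of the current run of square rows, and [rCur] the
   node of the word that the run spells. *)
Definition scan_column :=
  Assign rI (Lit 0) ;; Assign rCur (Lit 1) ;; Assign rRun (Lit 0) ;;
  While (Reg rI <' Reg rN)
    (Assign rA (Reg rI *' Reg rN +' Reg rJ) ;;
     Assign rC (Fetch (Reg rA)) ;;
     If (Reg rC =' Fetch (Reg rA +' Reg rP)) push
        (Assign rCur (Lit 1) ;; Assign rRun (Reg rI +' Lit 1)) ;;
     Assign rI (Reg rI +' Lit 1)).

(** The last clause is the capacity of the trie: node numbers stay below [K]. *)
Definition scan_env b B K KK R n p s :=
  [/\ [/\ (forall x d, x < K -> d < K -> x * K + d < KK), K + K <= KK,
          B + 3 * KK <= 2 ^ b, 2 < K & 0 < p],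
      [/\ n * n + n < B, n.+1 < 2 ^ b, n + p.*2 < 2 ^ b &
          forall a, a < n * n -> st_mem s a = R a /\ R a < K],
      [/\ st_reg s rBase = B, st_reg s rK = K, st_reg s rKK = KK, st_reg s rN = n &
          st_reg s rP = p] &
      forall qs, all (named_tandem R n p) qs -> uniq (map (names R n) qs) ->
        (size qs).+1 < K].

(** Only edges and links change; the middle third of the block stays clean for the renaming of
    pairs. *)
Definition mem_off B KK K s s' := forall x,
  ~~ (B <= x < B + KK) -> ~~ (B + 2 * KK <= x < B + 2 * KK + K) ->
  st_mem s' x = st_mem s x.

(** After row [i] the trie contains the word of the current run, hence by closure every tandem in
    this column that ends in row [i]. *)
Lemma scan_column_spec b B K KK R n p j qs s k :
  scan_env b B K KK R n p s -> j + p.*2 <= n -> st_reg s rJ = j ->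
  all (named_tandem R n p) qs -> trie_state B K KK R n qs s ->
  (forall q, named_tandem R n p q -> left q < j -> names R n q \in map (names R n) qs) ->
  wp b scan_column s k (fun s' k' => exists qs',
    [/\ [/\ all (named_tandem R n p) (qs ++ qs'), trie_state B K KK R n (qs ++ qs') s' &
         forall q, named_tandem R n p q -> left q < j.+1 ->
           names R n q \in map (names R n) (qs ++ qs')],
     st_out s' = st_out s ++ quads_code qs',
     agree_off [:: rCnt; rA; rC; rI; rCur; rX; rZ; rTop; rRun] (st_reg s) (st_reg s'),
     mem_off B KK K s s' &
     k' <= k + 50 + 200 * n + 100 * size qs']).
Proof.
case=> -[keyKK KK2 BW K2 p0] [nB nW pW HR] [EB EK EKK EN EP] bound jn EJ tqs Tqs Cqs.
have W1 : 1 < 2 ^ b by lia.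
rewrite /scan_column; do 3!wp_step.
pose sq i := R (i * n + j) = R (i * n + j + p).
pose w run i := names R n (run, j, i - run, p).
pose I i s' k' := exists qs' run,
  [/\ [/\ i <= n, run <= i, st_reg s' rI = i, st_reg s' rRun = run &
          st_reg s' rCur = node (trie_nodes R n (qs ++ qs')) (w run i)],
   [/\ all (named_tandem R n p) (qs ++ qs'), trie_state B K KK R n (qs ++ qs') s',
       w run i \in trie_nodes R n (qs ++ qs') & st_out s' = st_out s ++ quads_code qs'],
   [/\ forall r, run <= r -> r < i -> sq r, 0 < run -> ~ sq run.-1 &
       forall q, named_tandem R n p q ->
         left q < j \/ left q = j /\ top q + height q <= i ->
         names R n q \in map (names R n) (qs ++ qs')] &
   [/\ agree_off [:: rCnt; rA; rC; rI; rCur; rX; rZ; rTop; rRun] (st_reg s) (st_reg s'),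
       mem_off B KK K s s' & k' <= k + 40 + 200 * i + 100 * size qs']].
apply: (@wp_while _ _ _ _ _ n I) => [|i s' k' [? [? [[]]]]|i s' k'] //.
  exists [::], 0; rewrite cats0; split=> /=.
  - by split=> //; rewrite /w /names /= /node inE eqxx.
  - by split=> //; rewrite ?cats0 // inE eqxx.
  - split=> // q Hq [|[lq tq]]; first exact: Cqs.
    by case/and5P: Hq => _ hq _ _ _; lia.
  - split=> //; last by lia.
    by do !apply: agree_off_upd => //.
case=> qs' [run [[iN ri EI' ERun' ECur'] [tqs' [uF cF hD hL ECnt'] wF out']]].
case=> sqr Nsq Cq [ag off time].
have EB' : st_reg s' rBase = B by rewrite ag.
have EK' : st_reg s' rK = K by rewrite ag.
have EKK' : st_reg s' rKK = KK by rewrite ag.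
have EN' : st_reg s' rN = n by rewrite ag.
have EP' : st_reg s' rP = p by rewrite ag.
have EJ' : st_reg s' rJ = j by rewrite ag.
clear EB EK EKK EN EP EJ.
eexists; first ev.
case: (ltnP i n) => [lt_in|le_ni] /=; last first.
  have {le_ni iN} Ei : i = n by lia.
  exists qs'; split=> //; last by nlia.
  split=> // q Hq lq; apply: Cq => //.
  by case/and5P: Hq => _ _ tq _ _; lia.
have cell : i * n + j + p < n * n by nia.
have mem_R a : a < n * n -> st_mem s' a = R a.
  by move=> aN; rewrite off; [case: (HR a aN)|lia|lia].
have mem1 := mem_R _ (leq_ltn_trans (leq_addr p _) cell).
have mem2 := mem_R _ cell.
have [_ cK] := HR _ (leq_ltn_trans (leq_addr p _) cell).
do 3!wp_step.
(* If row [i] is not a square, no tandem of this column contains it and the run restarts below. *)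
case: (eqVneq (R (i * n + j)) (R (i * n + j + p))) => [Esq|Nsq'] /=; last first.
  do 3!wp_step.
  exists qs', i.+1; split=> /=.
  - by split=> //; [lia|lia|rewrite /w subnn /names /= /node inE eqxx].
  - by split=> //; rewrite /w subnn /names /= inE eqxx.
  - split=> [r|_|q Hq [lq|[lq tq]]].
    + by move=> r1 r2; lia.
    + by apply/eqP.
    + by apply: Cq => //; left.
    + apply: Cq => //; right; split=> //; rewrite leqNgt; apply/negP => lt_i.
      case/and5P: Hq => _ hq _ _ /allP/(_ i); rewrite mem_iota lq (negPf Nsq') => H.
      by suff: false by []; apply: H; lia.
  - split=> //; last by lia.
    by do !apply: agree_off_upd => //.
have sw : size (w run i) = i - run by rewrite size_map size_iota.
have sqr' r : run <= r -> r <= i -> sq r.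
  by move=> r1; rewrite leq_eqVlt => /predU1P[->|]; [|apply: sqr].
have tsuf t : t <= (i - run).+1 -> all (named_tandem R n p) (suffix_quads run i j p t).
  by move=> ti; apply: named_tandem_suffix.
have EF t : t <= (i - run).+1 ->
    trie_nodes R n (qs ++ qs') ++ ext (w run i) (R (i * n + j)) t =
    trie_nodes R n (qs ++ (qs' ++ suffix_quads run i j p t)).
  by move=> ti; rewrite /w ext_names // catA /trie_nodes [in RHS]map_cat.
have Ew : rcons (w run i) (R (i * n + j)) = w run i.+1.
  by rewrite /w /names /= subSn // -addn1 iotaD map_cat cats1 /= subnKC.
apply: wp_conseq.
  apply: (@push_spec b B K KK (trie_nodes R n (qs ++ qs')) (w run i) (R (i * n + j))
    run i j p) => //.
  - lia.
  - lia.
  - by rewrite size_trie_nodes; apply: ECnt'.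
  - by rewrite sw subnKC.
  - move=> t; rewrite sw => ti; rewrite EF // => /uniq_trie_nodes us.
    have := bound (qs ++ (qs' ++ suffix_quads run i j p t)); rewrite us.
    rewrite [in all _ _]catA all_cat tqs' tsuf // => /(_ isT isT).
    by rewrite !size_cat size_map size_iota size_trie_nodes size_cat; lia.
move=> s1 k1 [t]; rewrite sw => -[ti]; rewrite EF // Ew.
move=> [uF1 cF1 wF1 hD1 hL1] [ag1 ECnt1 ECur1 out1] off1 time1.
have EI1 : st_reg s1 rI = i by rewrite ag1.
wp_step.
exists (qs' ++ suffix_quads run i j p t), run; split=> /=.
- by split=> //; [lia|lia|rewrite ag1].
- split=> //.
  + by rewrite catA all_cat tqs' tsuf.
  + by split=> //=; rewrite ECnt1 !size_cat size_map size_trie_nodes size_iota size_cat; lia.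
  + by rewrite out1 out' quads_code_cat quads_code_suffix catA.
- split=> //.
  move=> q Hq [lq|[lq tq]].
    rewrite catA map_cat mem_cat Cq //; by left.
  case: (leqP (top q + height q) i) => [le_i|lt_i].
    rewrite catA map_cat mem_cat Cq //; by right.
  (* A tandem ending in row [i] cannot reach above the run, since the row before the run is not a
     square; its word is a suffix of the word of the run. *)
  have Etq : top q + height q = i.+1 by lia.
  case/and5P: Hq => _ hq tn _ /allP Hsq.
  have run_top : run <= top q.
    rewrite leqNgt; apply/negP => lt_run; apply: Nsq; first lia.
    have := Hsq run.-1; rewrite mem_iota lq => H; apply/eqP/H; lia.
  have Eq : names R n q = drop (top q - run) (w run i.+1).
    rewrite /w /names /= -map_drop drop_iota lq; congr [seq _ | r <- iota _ _]; lia.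
  have : names R n q \in trie_nodes R n (qs ++ (qs' ++ suffix_quads run i j p t)).
    by rewrite Eq; apply: mem_drop_closed.
  rewrite inE => /predU1P[E|//].
  by have := congr1 size E; rewrite size_map size_iota /=; lia.
- split=> //.
  + apply: agree_off_upd => //; apply: (agree_off_trans _ _ ag1) => //.
    by do !apply: agree_off_upd => //.
  + by move=> x Bx Lx; rewrite off1 // off.
  + by rewrite size_cat size_map size_iota; nlia.
Qed.

Definition scan :=
  Assign rCnt (Lit 1) ;; Assign rJ (Lit 0) ;;
  While (Reg rJ +' Lit 2 *' Reg rP <' Reg rN +' Lit 1)
    (scan_column ;; Assign rJ (Reg rJ +' Lit 1)).

Notation scan_regs := [:: rCnt; rA; rC; rJ; rI; rCur; rX; rZ; rTop; rRun] (only parsing).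

Lemma scan_env_preserved b B K KK R n p s s' :
  scan_env b B K KK R n p s -> agree_off scan_regs (st_reg s) (st_reg s') ->
  mem_off B KK K s s' -> scan_env b B K KK R n p s'.
Proof.
case=> H1 [nB nW pW HR] [EB EK EKK EN EP] bound ag off; split=> //.
  split=> // a aN; have [Ea Ra] := HR a aN; split=> //.
  by rewrite off //; lia.
by split; rewrite ag.
Qed.

(** One trie serves all columns, so a factor met in several of them is reported once. *)
Lemma scan_spec b B K KK R n p s k :
  scan_env b B K KK R n p s ->
  (forall x, B <= x < B + 3 * KK -> st_mem s x = 0) ->
  wp b scan s k (fun s' k' => exists qs,
    [/\ [/\ all (named_tandem R n p) qs, uniq (map (names R n) qs) &
         forall q, named_tandem R n p q -> names R n q \in map (names R n) qs],
     st_out s' = st_out s ++ quads_code qs,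
     agree_off scan_regs (st_reg s) (st_reg s'),
     mem_off B KK K s s' &
     k' <= k + 20 + (100 + 200 * n) * n.+1 + 100 * size qs]).
Proof.
move=> env zero; case: (env) => -[keyKK KK2 BW K2 p0] [nB nW pW HR] _ _.
case: (env) => _ _ [EB EK EKK EN EP] _.
have W1 : 1 < 2 ^ b by lia.
rewrite /scan; do 2!wp_step.
pose I j s' k' := exists qs,
  [/\ [/\ j <= n, st_reg s' rJ = j, st_out s' = st_out s ++ quads_code qs &
          all (named_tandem R n p) qs /\ trie_state B K KK R n qs s'],
     forall q, named_tandem R n p q -> left q < j ->
       names R n q \in map (names R n) qs,
     agree_off scan_regs (st_reg s) (st_reg s'),
     mem_off B KK K s s' &
     k' <= k + 10 + (100 + 200 * n) * j + 100 * size qs].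
apply: (@wp_while _ _ _ _ _ n I) => [|j s' k' [? [[]]]|j s' k'] //.
  exists [::]; split=> //=; last by lia.
    split=> //; first by rewrite cats0.
    split=> //; split=> //=.
    - move=> u; rewrite inE => /eqP ->; split; first exact: mem_head.
      by case=> [|? ?] ?.
    - split=> [u c|x c].
        rewrite inE => /eqP -> cK; have := keyKK 1 c.
        by rewrite /trie_nodes /node /= => H1; rewrite zero //; lia.
      by move=> /= _ xK cK; have H := keyKK x c xK cK; rewrite zero //; lia.
    - split=> [|u]; first by rewrite zero //; lia.
      by rewrite inE => ->.
  by do !apply: agree_off_upd => //.
case=> qs [[jn EJ' out' [tqs Tqs]] Cqs ag off time].
have EN' : st_reg s' rN = n by rewrite ag.
have EP' : st_reg s' rP = p by rewrite ag.
eexists; first ev.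
case: (ltnP (j + 2 * p) (n + 1)) => [lt_jn|le_nj] /=; last first.
  exists qs; split=> //; last by nia.
  split=> //; first by case: Tqs => /uniq_trie_nodes.
  move=> q Hq; apply: Cqs => //; case/and5P: Hq => _ _ _ lq _; lia.
apply: wp_seq; apply: wp_conseq.
  apply: (scan_column_spec (j := j) _ (scan_env_preserved env ag off) _ EJ' tqs Tqs Cqs).
  by lia.
move=> s1 k1 [qs' [[tqs1 Tqs1 Cqs1] out1 ag1 off1 time1]].
have EJ1 : st_reg s1 rJ = j by rewrite ag1.
wp_step; exists (qs ++ qs'); split=> //=.
- split=> //; [lia|lia|by rewrite out1 out' quads_code_cat catA].
- by apply: agree_off_upd => //; apply: agree_off_trans ag1.
- by move=> x Bx Lx; rewrite off1 // off.
- by rewrite size_cat; nlia.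
Qed.

(** Names of segments that would straddle two rows are left arbitrary. *)
Definition names_ok (T : eqType) n (A : 'M[T]_n) p (R : nat -> nat) :=
  forall i j i' j', i < n -> i' < n -> j + p <= n -> j' + p <= n ->
  (R (i * n + j) = R (i' * n + j') <->
   forall c, c < p -> entry A i (j + c) = entry A i' (j' + c)).

Lemma named_tandemE (T : eqType) n (A : 'M[T]_n) p R q : 0 < p ->
  names_ok A p R -> named_tandem R n p q = (period q == p) && tandem_at A q.
Proof.
move=> p0 ok; apply/idP/andP.
  case/and5P=> /eqP Ep h0 tn ln /allP H; split; first by rewrite Ep.
  apply/tandem_atP; split; rewrite ?Ep // => r c rh cp.
  have := H (top q + r); rewrite mem_iota -addnA => E.
  have [||||Hok _] := ok (top q + r) (left q) (top q + r) (left q + p); [lia..|].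
  rewrite Hok //; first by rewrite addnAC.
  by apply/eqP/E; lia.
case=> /eqP Ep /tandem_atP[h0 w0 tn ln H]; rewrite Ep in ln H.
apply/and5P; split; rewrite ?Ep //; apply/allP => r; rewrite mem_iota => Hr.
apply/eqP; rewrite -addnA; apply/ok; [lia..|] => c cp.
have -> : r = top q + (r - top q) by lia.
by rewrite addnAC -H //; lia.
Qed.

(** The names on the left edge describe the first half, and the second half repeats it. *)
Lemma names_content (T : eqType) n (A : 'M[T]_n) p R q q' : 0 < p ->
  names_ok A p R -> named_tandem R n p q -> named_tandem R n p q' ->
  names R n q = names R n q' <-> content A q = content A q'.
Proof.
move=> p0 ok Hq Hq'; have := Hq; have := Hq'; rewrite !(named_tandemE _ p0 ok).
case/andP=> /eqP Ep' tq' /andP[/eqP Ep tq].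
case/tandem_atP: (tq) => h0 _ tn ln H; case/tandem_atP: (tq') => h0' _ tn' ln' H'.
rewrite Ep Ep' in ln ln' H H'.
split=> [E|/contentP[Eh _ E]].
  have Eh : height q = height q' by have := congr1 size E; rewrite !size_map !size_iota.
  apply/contentP; rewrite Ep Ep'; split=> // r c rh cp.
  have {}E x : x < p -> entry A (top q + r) (left q + x) = entry A (top q' + r) (left q' + x).
    move=> xp; have := congr1 (nth 0 ^~ r) E.
    rewrite /= !(nth_map 0) ?size_iota -?Eh // !nth_iota -?Eh // => /ok; apply=> //; lia.
  case: (ltnP c p) => [|pc]; first exact: E.
  have -> : c = c - p + p by lia.
  rewrite !addnA -H; [|lia..]; rewrite -H'; [|lia..]; apply: E; lia.
rewrite /names -Eh; apply: (@eq_from_nth _ 0) => [|r]; rewrite !size_map !size_iota //.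
move=> rh; rewrite !(nth_map 0) ?size_iota // !nth_iota //.
by apply/ok; [lia..|] => c cp; apply: E => //; lia.
Qed.

Lemma names_okS (T : eqType) n (A : 'M[T]_n) p R R' : 0 < p -> names_ok A p R ->
  (forall a a', a < n * n -> a' < n * n ->
     (R' a = R' a' <-> R a = R a' /\ R a.+1 = R a'.+1)) ->
  names_ok A p.+1 R'.
Proof.
move=> p0 ok H i j i' j' ni ni' jn jn'.
rewrite H; [|nia..]; rewrite -!addnS !ok; [|lia..].
split=> [[H1 H2] c cp|E]; last first.
  split=> c cp; first by apply: E; lia.
  by rewrite !addSnnS; apply: E.
case: (ltnP c p) => [|pc]; first exact: H1.
have -> : c = p.-1.+1 by lia.
by rewrite -!addSnnS; apply: H2; lia.
Qed.

(** * The program *)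

Lemma nth_allpairs (S T R : Type) x0 y0 z0 (f : S -> T -> R) (s : seq S) (t : seq T) i j :
  i < size s -> j < size t ->
  nth z0 [seq f x y | x <- s, y <- t] (i * size t + j) = f (nth x0 s i) (nth y0 t j).
Proof.
elim: s i => // x s IH [|i] si tj; rewrite allpairs_cons nth_cat size_map /=.
  by rewrite add0n tj (nth_map y0).
rewrite mulSn -addnA ltnNge leq_addr /= addKn; exact: IH.
Qed.

Lemma entry_init n (A : 'M[nat]_n) i j : i < n -> j < n ->
  entry A i j = Some (st_mem (init A) (i * n + j)).
Proof.
move=> ni nj; have := @nth_allpairs _ _ _ (Ordinal ni) (Ordinal nj) 0 (fun i j => A i j)
  (enum 'I_n) (enum 'I_n) i j.
rewrite !size_enum_ord => /(_ ni nj) /= ->.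
by rewrite (nth_ord_enum _ (Ordinal ni)) (nth_ord_enum _ (Ordinal nj)) (@entry_ord _ _ _ A (Ordinal ni) (Ordinal nj)).
Qed.

Lemma init_mem_oob n (A : 'M[nat]_n) x : n * n <= x -> st_mem (init A) x = 0.
Proof. by move=> nx; rewrite /= nth_default // size_allpairs !size_enum_ord. Qed.

(* Letters are arbitrary machine words.  A letter v >= K^3 is looked up in cell v,
   a smaller one in cell v + K^3, and the bit tells them apart: the cells below
   K^3 stay free for the other tables. *)
Definition letters_pre :=
  Assign rBit (Fetch (Reg rA) <' Reg rKKK) ;;
  Assign rC (Fetch (Reg rA) +' Reg rBit *' Reg rKKK).

Definition rename_pre :=
  Assign rC (Reg rBase +' Reg rKK +'
    (Fetch (Reg rA) *' Reg rK +' Fetch (Reg rA +' Lit 1))) ;;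
  Assign rBit (Lit 0).

Definition stage :=
  scan ;; naming rename_pre ;;
  Assign rBase (Reg rBase +' Lit 3 *' Reg rKK) ;; Assign rP (Reg rP +' Lit 1).

(* K = (n+2)^4 exceeds all names and node numbers.  The cells below n^2 hold the
   current names.  Stage p uses [rBase, rBase + 3 K^2): the trie edges, the table
   of the pairs of names, the suffix links; the next stage starts on a zeroed
   block above. *)
Definition report_tandems :=
  Assign rX (Reg rN +' Lit 2) ;;
  Assign rK (Reg rX *' Reg rX *' Reg rX *' Reg rX) ;;
  Assign rKK (Reg rK *' Reg rK) ;;
  Assign rKKK (Reg rKK *' Reg rK) ;;
  Assign rNN (Reg rN *' Reg rN) ;;
  naming letters_pre ;;
  Assign rP (Lit 1) ;; Assign rBase (Reg rK) ;;
  While (Lit 2 *' Reg rP <' Reg rN +' Lit 1) stage.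

Lemma letters_spec b n (A : 'M[nat]_n) P s k :
  (forall i j, A i j < 2 ^ b) -> 2 * (n * n) + 1 < P -> 2 * P <= 2 ^ b ->
  st_mem s = st_mem (init A) -> st_reg s rKKK = P -> st_reg s rNN = n * n ->
  wp b (naming letters_pre) s k (fun s' k' =>
    [/\ agree_off [:: rCnt; rA; rBit; rC] (st_reg s) (st_reg s') /\
        st_out s' = st_out s,
     forall a, a < n * n -> st_mem s' a <= 2 * (n * n) + 1,
     names_ok A 1 (st_mem s'),
     forall x, n * n <= x -> x < P -> st_mem s' x = 0 &
     k' <= k + 60 * (n * n).+1]).
Proof.
move=> HA NP PW Em EP EN; pose L := st_mem (init A).
have LW a : a < n * n -> L a < 2 ^ b.
  move=> aN; have n0 : 0 < n by case: (n) aN.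
  have ni : a %/ n < n by rewrite ltn_divLR.
  have nj : a %% n < n by rewrite ltn_pmod.
  have := entry_init A ni nj; rewrite -divn_eq (@entry_ord _ _ _ A (Ordinal ni) (Ordinal nj)).
  by move=> [E]; rewrite /L /= -E.
have W1 : 1 < 2 ^ b by lia.
apply: wp_conseq.
  (* All memory from [P] up is the table; letters below [P] are shifted by [P], which fits as
     [2 * P <= 2 ^ b]. *)
  apply: (@naming_spec b letters_pre (n * n) P (2 ^ b) 20
    (fun a => L a + (L a < P) * P) (fun a => L a < P) L) => //.
  - lia.
  - lia.
  - by move=> a; rewrite Em.
  - by move=> x /andP[Px _]; apply: init_mem_oob; lia.
  - by move=> a /LW; case: (ltnP (L a) P) => /=; lia.
  move=> a s' k' aN ag EA Ea _; rewrite /letters_pre.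
  have EP' : st_reg s' rKKK = P by rewrite ag.
  have := LW a aN => La.
  wp_step; wp_step.
  split=> //=; last by split=> //; lia.
  by do !apply: agree_off_upd => //.
move=> s' k' [[ag out] le ok off time]; split=> //.
- move=> i j i' j' ni ni' jn jn'.
  have cell x y : x < n -> y + 1 <= n -> x * n + y < n * n by nia.
  rewrite ok; [|exact: cell..].
  split=> [[E1 E2] c|/(_ 0 isT)].
    case: c => // _; rewrite !addn0 !entry_init; [congr Some|lia..].
    rewrite -/L; move: E1 E2; case: (ltnP (L (i * n + j)) P); case: (ltnP (L (i' * n + j')) P); lia.
  by rewrite !addn0 !entry_init; [move=> [E]; rewrite /L /= E|lia..].
- move=> x Nx xP; rewrite off; [exact: init_mem_oob|by []|by rewrite leqNgt xP].
Qed.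

Lemma names_ok_eq (T : eqType) n (A : 'M[T]_n) p R R' : 0 < p ->
  (forall a, a < n * n -> R' a = R a) -> names_ok A p R -> names_ok A p R'.
Proof.
move=> p0 E ok i j i' j' ni ni' jn jn'; rewrite -(ok i j i' j') //.
by rewrite !E //; nia.
Qed.

Lemma rename_spec b n (A : 'M[nat]_n) p B K KK s k : 0 < p ->
  (forall x d, x < K -> d < K -> x * K + d < KK) ->
  n * n < B -> B + 3 * KK <= 2 ^ b -> 2 * (n * n) + 1 < K -> K <= KK ->
  st_reg s rBase = B -> st_reg s rK = K -> st_reg s rKK = KK -> st_reg s rNN = n * n ->
  (forall a, a < n * n -> st_mem s a < K) -> st_mem s (n * n) = 0 ->
  (forall x, B + KK <= x < B + 2 * KK -> st_mem s x = 0) ->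
  names_ok A p (st_mem s) ->
  wp b (naming rename_pre) s k (fun s' k' =>
    [/\ agree_off [:: rCnt; rA; rBit; rC] (st_reg s) (st_reg s') /\
        st_out s' = st_out s,
     forall a, a < n * n -> st_mem s' a <= 2 * (n * n) + 1,
     names_ok A p.+1 (st_mem s'),
     forall x, n * n <= x -> ~~ (B + KK <= x < B + 2 * KK) -> st_mem s' x = st_mem s x &
     k' <= k + 60 * (n * n).+1]).
Proof.
move=> p0 keyKK NB BW NK KKK EB EK EKK EN mK mN mz ok.
(* The last cell is paired with cell [n * n], whose value 0 keeps the key inside the table. *)
have mK' a : a <= n * n -> st_mem s a < K.
  by rewrite leq_eqVlt => /predU1P[->|/mK //]; rewrite mN; lia.
pose key a := B + KK + (st_mem s a * K + st_mem s a.+1).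
have W1 : 1 < 2 ^ b by lia.
apply: wp_conseq.
  apply: (@naming_spec b rename_pre (n * n) (B + KK) (B + 2 * KK) 20
    key (fun=> 0) (st_mem s)) => //.
  - lia.
  - lia.
  - lia.
  - by move=> a aN; have := keyKK _ _ (mK' a (ltnW aN)) (mK' _ aN); rewrite /key; lia.
  move=> a s' k' aN ag EA Ea Ea1; rewrite /rename_pre.
  have EB' : st_reg s' rBase = B by rewrite ag.
  have EK' : st_reg s' rK = K by rewrite ag.
  have EKK' : st_reg s' rKK = KK by rewrite ag.
  have := keyKK _ _ (mK' a (ltnW aN)) (mK' _ aN) => Hkey.
  have {}Ea1 : st_mem s' (a + 1) = st_mem s a.+1 by rewrite addn1.
  wp_step; wp_step.
  split=> //=; last by split=> //; lia.
  by do !apply: agree_off_upd => //.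
move=> s' k' [[ag out] le okn off time]; split=> //.
apply: (names_okS p0 ok) => a a' aN aN'; rewrite okn // /key; split.
  by case=> /addnI/(key_inj (mK' _ aN) (mK' _ aN')).
by case=> -> ->.
Qed.

Definition reported (T : eqType) n (A : 'M[T]_n) p qs :=
  [/\ all (tandem_at A) qs, uniq (map (content A) qs),
     (forall q, q \in qs -> period q < p) &
     forall q, tandem_at A q -> period q < p -> content A q \in map (content A) qs].

(** Different stages report different widths, and within a stage the names separate the contents. *)
Lemma reportedS (T : eqType) n (A : 'M[T]_n) p R qs qs' : 0 < p -> names_ok A p R ->
  reported A p qs ->
  all (named_tandem R n p) qs' -> uniq (map (names R n) qs') ->
  (forall q, named_tandem R n p q -> names R n q \in map (names R n) qs') ->
  reported A p.+1 (qs ++ qs').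
Proof.
move=> p0 ok [tqs uqs hqs cqs] /allP nqs' uqs' cqs'.
have tqs' q : q \in qs' -> period q = p /\ tandem_at A q.
  by move=> /nqs'; rewrite (named_tandemE _ p0 ok) => /andP[/eqP].
split.
- by rewrite all_cat tqs; apply/allP => q /tqs'[].
- rewrite map_cat cat_uniq uqs /=; apply/andP; split.
    apply/hasPn => _ /mapP[q /tqs'[hq _] ->]; apply/mapP => -[q1 /hqs hq1].
    by case/contentP => _ E _; move: hq1; rewrite -E hq ltnn.
  apply: uniq_map_transfer uqs' _ => x y xs ys.
  by move/(names_content p0 ok (nqs' _ xs) (nqs' _ ys)).
- move=> q; rewrite mem_cat => /orP[/hqs|/tqs'[-> _]]; lia.
- move=> q tq; rewrite ltnS leq_eqVlt map_cat mem_cat => /predU1P[hq|hq].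
    have nq : named_tandem R n p q by rewrite (named_tandemE _ p0 ok) hq eqxx.
    have /mapP[q' q's E] := cqs' q nq; apply/orP; right; apply/mapP; exists q' => //.
    by apply/(names_content p0 ok nq (nqs' _ q's)).
  by rewrite cqs.
Qed.

Definition stage_ready n (A : 'M[nat]_n) p B K KK KKK s :=
  [/\ [/\ st_reg s rN = n, st_reg s rP = p, st_reg s rBase = B, st_reg s rK = K &
          st_reg s rKK = KK], st_reg s rNN = n * n,
     (forall a, a < n * n -> st_mem s a <= 2 * (n * n) + 1) /\ st_mem s (n * n) = 0,
     forall x, B <= x < KKK -> st_mem s x = 0 & names_ok A p (st_mem s)].

Lemma stage_spec b n (A : 'M[nat]_n) p B K KK KKK qs s k :
  0 < p -> 2 * p <= n -> (forall x d, x < K -> d < K -> x * K + d < KK) ->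
  K + K <= KK -> n * n + n < B -> B + 3 * KK <= KKK -> KKK < 2 ^ b ->
  2 * (n * n) + 1 < K -> 2 * n ^ 3 + 1 < K ->
  stage_ready A p B K KK KKK s -> reported A p qs -> st_out s = quads_code qs ->
  wp b stage s k (fun s' k' => exists qs',
    [/\ stage_ready A p.+1 (B + 3 * KK) K KK KKK s', reported A p.+1 (qs ++ qs'),
     st_out s' = quads_code (qs ++ qs') &
     k' <= k + 400 * n.+1 ^ 2 + 100 * size qs']).
Proof.
move=> p0 pn keyKK KK2 nB BK KW NK n3K [[EN EP EB EK EKK] ENN [mR mN] zero ok] rep out.
have W1 : 1 < 2 ^ b by lia.
have nn : n <= n * n by case: (n) => // m; rewrite leq_pmulr.
have env : scan_env b B K KK (st_mem s) n p s.
  split=> //.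
  - by split=> //; lia.
  - split; [lia|lia|lia|] => a aN; split=> //; have := mR a aN; lia.
  (* Distinct words mean distinct contents, so the combinatorial bound keeps the trie below [K]
     nodes. *)
  - move=> qs0 /allP nqs0 uqs0.
    have tqs0 : all (tandem_at A) qs0.
      by apply/allP => q /nqs0; rewrite (named_tandemE _ p0 ok) => /andP[].
    have := distinct_tandems_bound tqs0 => /(_ _)/(leq_trans _) H.
    suff : size qs0 <= 2 * n ^ 3 by lia.
    apply: distinct_tandems_bound tqs0 _.
    apply: uniq_map_transfer uqs0 _ => x y xs ys.
    by move/(names_content p0 ok (nqs0 _ xs) (nqs0 _ ys)).
rewrite /stage; apply: wp_seq; apply: wp_conseq.
  by apply: scan_spec env _ => x Hx; apply: zero; lia.
move=> s1 k1 [qs' [[nqs' uqs' cqs'] out1 ag1 off1 time1]].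
have mem1 a : a <= n * n -> st_mem s1 a = st_mem s a.
  by move=> aN; rewrite off1; [|lia|lia].
have EB1 : st_reg s1 rBase = B by rewrite ag1.
have EK1 : st_reg s1 rK = K by rewrite ag1.
have EKK1 : st_reg s1 rKK = KK by rewrite ag1.
apply: wp_seq; apply: wp_conseq.
  apply: (@rename_spec b n A p B K KK) => //.
  - lia.
  - lia.
  - lia.
  - by rewrite ag1.
  - by move=> a aN; rewrite mem1 ?(ltnW aN) //; have := mR a aN; lia.
  - by rewrite mem1.
  - by move=> x Hx; rewrite off1 ?zero //; lia.
  - by apply: names_ok_eq ok => // a aN; rewrite mem1 // ltnW.
move=> s2 k2 [[ag2 out2] mR2 ok2 off2 time2].
have EB2 : st_reg s2 rBase = B by rewrite ag2.
have EKK2 : st_reg s2 rKK = KK by rewrite ag2.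
have EP2 : st_reg s2 rP = p by rewrite ag2 ?ag1.
do 2!wp_step.
exists qs'; split=> /=.
- split=> //=.
  + by split=> //; rewrite ?addn1 // ag2 ?ag1.
  + by rewrite ag2 ?ag1.
  + by split=> //; rewrite off2 ?mem1 //; lia.
  + by move=> x Hx; rewrite off2 ?off1 ?zero //; lia.
- exact: reportedS ok rep nqs' uqs' cqs'.
- by rewrite out2 out1 out quads_code_cat.
- have : (n * n).+1 <= n.+1 ^ 2 by rewrite expnS expn1; lia.
  have : (100 + 200 * n) * n.+1 <= 200 * n.+1 ^ 2 by rewrite expnS expn1; nia.
  have : 0 < n.+1 ^ 2 by rewrite expn_gt0.
  lia.
Qed.

Definition report_time n := 2000 * n.+1 ^ 3.

(** Each half width costs a quadratic scan and a constant per report; the reports number at most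
    [2 * n ^ 3] over all stages. *)
Lemma report_tandems_spec b n (A : 'M[nat]_n) :
  n.+2 ^ 13 <= 2 ^ b -> (forall i j, A i j < 2 ^ b) ->
  wp b report_tandems (init A) 0 (fun s k => exists qs,
    [/\ k <= report_time n, st_out s = quads_code qs, all (tandem_at A) qs,
     uniq (map (content A) qs) &
     forall q, tandem_at A q -> content A q \in map (content A) qs]).
Proof.
(* Powers are replaced by variables to keep the arithmetic tractable. *)
move=> nW HA; have [m Em] : exists m, n + 2 = m by eexists.
have [K EK] : exists K, m * m * m * m = K by eexists.
have m2 : 2 <= m by lia.
have mm : m * m * m * 2 <= K by rewrite -EK leq_mul2l m2 orbT.
have n3 : m * m * m = n ^ 3 + 6 * n ^ 2 + 12 * n + 8 by rewrite -Em; lia.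
have n0 : n * n <= n ^ 3 by rewrite mulnn; case: (n) => // ?; rewrite leq_pexp2l.
have K3n : 3 * n < K by lia.
have NK : 2 * (n * n) + 1 < K by lia.
have n3K : 2 * n ^ 3 + 1 < K by lia.
have nnK : n * n + n < K by lia.
(* Twelve of the thirteen factors make up K^3, and the last one pays for the 2. *)
have KW : 2 * (K * K * K) <= 2 ^ b.
  apply: leq_trans nW; rewrite -[n.+2]addn2 Em [m ^ 13]expnS.
  have -> : m ^ 12 = K * K * K by rewrite -EK; lia.
  by rewrite leq_mul2r m2 orbT.
have keyKK := @key_lt K.
have KK2 : K + K <= K * K by rewrite addnn -mul2n leq_mul2r; lia.
(* Room below K^3 for the first [K] cells and [n] blocks of size 3 K^2. *)
have KK3 : K * K * (3 * n).+1 <= K * K * K by rewrite leq_mul2l; lia.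
have KKK : K * K <= K * K * K by rewrite leq_pmulr; lia.
have m1 : m * m * m <= K by lia.
have m0 : m * m <= m * m * m by rewrite leq_pmulr; lia.
have ENk : st_reg (init A) rN = n by [].
have W1 : 1 < 2 ^ b by lia.
rewrite /report_tandems.
apply: wp_seq; apply: (@wp_assign _ _ _ _ _ m).
  by rewrite -Em; ev.
apply: wp_seq; apply: (@wp_assign _ _ _ _ _ K).
  by rewrite -EK; ev; simpl; lia.
do 3!wp_step.
clear EK Em m2 mm n3 m1 m0.
have [KK EKK] : exists KK, KK = K * K by eexists.
rewrite -EKK in keyKK KK2 KK3 KKK KW *.
have [K3 EK3] : exists K3, K3 = KK * K by eexists.
rewrite -EK3 in KK3 KKK KW *.
apply: wp_seq; apply: wp_conseq.
  by apply: (@letters_spec b n A K3) => //; lia.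
move=> s1 k1 [[ag1 out1] mR1 ok1 zero1 time1].
have EK1 : st_reg s1 rK = K by rewrite ag1.
do 2!wp_step.
pose I t s k := exists qs, [/\ t <= n, stage_ready A t.+1 (K + t * (3 * KK)) K KK K3 s,
  reported A t.+1 qs, st_out s = quads_code qs &
  k <= 200 + 60 * (n * n).+1 + 420 * n.+1 ^ 2 * t + 100 * size qs].
apply: (@wp_while _ _ _ _ _ n I) => [|t s k [? []]|t s k] //.
  exists [::]; split=> //.
  - split=> //=.
    + by split=> //; rewrite ?ag1 //; lia.
    + by rewrite ag1.
    + by split=> //; apply: zero1; lia.
    + by move=> x Hx; apply: zero1; lia.
  - by split=> // q /tandem_atP[_ h0 _ _ _]; lia.
  - by move: time1 => /=; lia.
case=> qs [tn ready rep out time]; case: (ready) => [[EN EP EB _ EKK'] _ _ _ _].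
eexists; first ev.
case: (ltnP (2 * t.+1) (n + 1)) => [lt_tn|le_nt] /=; last first.
  case: rep => tqs uqs _ cqs; exists qs; split=> //.
    have := distinct_tandems_bound tqs uqs; rewrite /report_time.
    have : 420 * n.+1 ^ 2 * t <= 420 * n.+1 ^ 2 * n by rewrite leq_mul2l tn orbT.
    lia.
  (* On exit [n < 2 * t.+1], so every half width has been treated. *)
  by move=> q tq; apply: cqs => //; case/tandem_atP: tq; lia.
apply: wp_conseq.
  apply: (stage_spec (b := b) _ _ _ _ _ _ _ _ _ _ ready rep out) => //; try lia.
  have : t.+1 * (3 * KK) <= n * (3 * KK) by rewrite leq_mul2r; lia.
  lia.
move=> s2 k2 [qs' [ready2 rep2 out2 time2]]; exists (qs ++ qs'); split=> //.
- lia.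
- by have -> : K + t.+1 * (3 * KK) = K + t * (3 * KK) + 3 * KK by lia.
- rewrite size_cat; have : 0 < n.+1 ^ 2 by rewrite expn_gt0.
  move: time2 => /=; lia.
Qed.

Lemma report_tandems_correct : reports_in_time report_tandems 11 report_time.
Proof.
move=> n b A nW HA.
have [s [k [Hex [qs [Hk out tqs uqs cqs]]]]] := report_tandems_spec nW HA.
exists s, k; split=> //.
have [os [E1 E2]] := occurrences_of_quads tqs; exists os.
split; first by rewrite out /quads_code -E1.
apply: (@lists_distinct_tandems_of_quads _ _ _ A _ qs) => //.
by rewrite -map_comp.
Qed.

Theorem theorem6 :
  (exists2 f : nat -> nat,
     forall n, is_max_distinct_tandems n (f n) &
     is_Theta f (fun n => n ^ 3)) /\
  (exists (p : prog) (c : nat) (t : nat -> nat),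
     reports_in_time p c t /\ is_Theta t (fun n => n ^ 3)) /\
  (forall (p : prog) (c : nat) (t : nat -> nat),
     reports_in_time p c t -> is_Omega t (fun n => n ^ 3)).
Proof.
split; [|split].
- have [f fP] := choice max_distinct_tandems_exists; exists f => //.
  apply: (@is_Theta_of_le _ _ 64 2 2) => // n n2.
  have [lo hi] := max_distinct_tandems_bounds (fP n); split=> //.
  by apply: leq_trans (cube_half n2) _; rewrite leq_mul2l lo.
(* The constant 11 yields the exponent 13 of the word-length condition. *)
- exists report_tandems, 11, report_time; split; first exact: report_tandems_correct.
  apply: (@is_Theta_of_le _ _ 1 (2000 * 2 ^ 3) 1) => // n n1; rewrite /report_time mul1n.
  have le_S : n ^ 3 <= n.+1 ^ 3 by rewrite leq_exp2r.
  have le_2 : n.+1 ^ 3 <= (2 * n) ^ 3 by rewrite leq_exp2r; lia.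
  rewrite expnMn in le_2; split; first exact: leq_trans le_S (leq_pmull _ _).
  by rewrite -mulnA leq_mul2l le_2.
- move=> p c t /reporting_time_lower_bound lo.
  apply: (@is_Omega_of_le _ _ 64 2) => // n n2.
  by apply: leq_trans (cube_half n2) _; rewrite leq_mul2l lo.
Qed.
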